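(* Let $q=e^{2\pi i z}$ and let $\eta(z)=q^{1/24}\prod_{n\ge1}(1-q^n)$ be the Dedekind eta function. Define \[ g(z)=\eta^2(4z)\eta^2(8z),\qquad L(z)=\frac{\eta^6(8z)}{\eta^2(4z)\eta^4(16z)},\qquad F(z)=-g(z)L(2z)=\sum_{n\ge -1}C(n)q^n . \] Let $p\equiv 3\pmod 4$ be prime. Then for all integers $m\ge 0$, \[ v_p\big(C(p^{2m+1})\big)=m,\qquad v_p\!\left(\frac{F\,|\,U(p^{2m+1})}{C(p^{2m+1})}-g\right)\ge m+1 . \]
   Context: For a positive integer $m$, the operator $U(m)$ acts on $q$-expansions by $\sum a(n)q^n\,|\,U(m)=\sum a(mn)q^n$. For a formal Laurent series in $q$ with rational coefficients, $v_p$ denotes the minimum of the $p$-adic valuations of its coefficients (and $v_p(0)=\infty$); for a rational number it is the usual $p$-adic valuation. The functions $g,L,F$ are identified with their $q$-expansions; $F$ has integer coefficients $C(n)$, with $F=-q^{-1}+2q^3+q^7-\cdots$. *)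

(* Defs.v *)
From mathcomp Require Import all_boot all_algebra.
Set Implicit Arguments. Unset Strict Implicit. Unset Printing Implicit Defensive.
Import GRing.Theory Num.Theory.
Local Open Scope ring_scope.

(* Laurent q-series with rational coefficients are modelled by their
   coefficient functions  int -> rat  (n |-> coefficient of q^n). *)

(* Truncation (up to degree N) of the formal power series
   prod_{k>=1} (1 - x^(d k))^r,  r : int.  For r < 0 each factor
   (1 - x^(d k))^(-1) is replaced by the geometric series sum_{j<=N} x^(d k j);
   all coefficients of degree <= N are exact (for d >= 1). *)
Definition eta_factor (d : nat) (r : int) (N : nat) : {poly rat} :=
  \prod_(1 <= k < N.+1)
     (if (0 <= r) then (1 - 'X^(d * k)) ^+ absz r
      else (\sum_(j < N.+1) 'X^(d * k * j)) ^+ absz r).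

(* The eta quotient  prod_{(d,r) in rs} eta(d z)^r
   = q^(sum d r / 24) prod_{(d,r)} prod_{k>=1} (1 - q^(d k))^r. *)
Definition eta_shift (rs : seq (nat * int)) : int :=
  ((\sum_(x <- rs) (x.1%:Z * x.2)) %/ 24)%Z.

Definition etaquot (rs : seq (nat * int)) (n : int) : rat :=
  match n - eta_shift rs with
  | Posz k => (\prod_(x <- rs) eta_factor x.1 x.2 k)`_k
  | Negz _ => 0
  end.

Definition g_ser : int -> rat := etaquot [:: (4%N, 2%:Z); (8%N, 2%:Z)].

(* L(z) = eta^6(8z) / (eta^2(4z) eta^4(16z)), hence
   L(2z) = eta^6(16z) / (eta^2(8z) eta^4(32z)), and
   F(z) = - g(z) L(2z) = - eta^2(4z) eta^2(8z) eta^6(16z) eta^-2(8z) eta^-4(32z). *)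
Definition F_ser : int -> rat := fun n =>
  - etaquot [:: (4%N, 2%:Z); (8%N, 2%:Z); (16%N, 6%:Z); (8%N, (-2)%Z); (32%N, (-4)%Z)] n.

Definition C (n : int) : rat := F_ser n.

Definition Uop (m : nat) (f : int -> rat) : int -> rat := fun n => f (m%:Z * n).

Definition vp_rat (p : nat) (x : rat) : int :=
  (logn p (absz (numq x)))%:Z - (logn p (absz (denq x)))%:Z.

(* v_p(f) >= k for a q-series f: every nonzero coefficient has valuation >= k
   (v_p(0) = oo). *)
Definition vp_ser_ge (p : nat) (f : int -> rat) (k : int) : Prop :=
  forall n : int, f n != 0 -> k <= vp_rat p (f n).

(* Main.v *)
(* Let w = q^4 and s = L(2z)^(-1/2) = q + ..., an integral power series in q.
   With x = L(2z), g dq/q is the differential - dx / (2 y) on y^2 = x^3 + 4 x, so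
   that g dq/q = (1 + 4 s^4)^(-1/2) ds and F dq/q = - s^(-2) (1 + 4 s^4)^(-1/2) ds.
   These are theta identities.  They follow from Gauss' product for
   sum (-1)^n w^(n^2) and from the AGM relations between phi(w), phi(-w) and
   their values at w^2, which also give Jacobi's formula for eta^3 and hence the
   expansion of g as a theta series with complex multiplication; the latter shows
   a(p^2 n) = - p a(n).

   Expanding (1 + 4 s^4)^(-1/2) in powers of s, the coefficients of F at p^k n and
   of g at p^(k+1) n become sums over exponents l = 4 i - 1 and p l.  The
   congruence [s^(p l)]_(p n) = [s^l]_n modulo p l and the p-adic continuity in l
   of the ratio of the central binomial coefficients attached to p l and l give
     alpha p C(p^k n) = beta a(p^(k+1) n)  modulo p^(k+1)
   with alpha and beta prime to p.  For k = 2 m + 1 the right-hand side is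
   beta (- p)^(m+1) a(n), which yields both assertions. *)

From HB Require Import structures.
Require Import Defs.
From mathcomp Require Import all_boot all_order all_algebra finfield.
From mathcomp Require Import boolp ring zify.
Set Implicit Arguments. Unset Strict Implicit. Unset Printing Implicit Defensive.
Import Order.TTheory GRing.Theory Num.Theory.
Local Open Scope ring_scope.

(** * Formal power series *)

(** Since p = 3 modulo 4, the exponent p (4 i - 1) is 1 modulo 4. This is why the exponents 4 i - 1
    of F are matched with exponents of the other family 4 j + 1, which belongs to g. The exponents 4
    j + 1 prime to p contribute multiples of p^(k+1) at the index p^(k+1) n, and the polar term of F
    is exact, so p times its coefficient at p^k n is such a multiple too. The obstacle is that the
    ratio of central binomial coefficients is constant only up to a precision depending on the
    exponent l. If p^e exactly divides l, with e at most k, the ratio is controlled modulo p^(e+1).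
    The coefficient of s^(l-1) ds at p^k n is p^k n / l times that of s^l, hence a multiple of
    p^(k-e). The two effects always combine to p^(k+1). After one factor p is cancelled, the
    precision p^(2 m + 1) is just enough: m is spent on dividing by C(p^(2 m + 1)) and m + 1
    remains. *)

Record fps (R : Type) := Fps { fcoef :> nat -> R }.

Lemma fpsP (R : Type) (f g : fps R) : (forall n, f n = g n) -> f = g.
Proof. by case: f => f; case: g => g /= /funext ->. Qed.

HB.instance Definition _ (R : Type) := gen_eqMixin (fps R).
HB.instance Definition _ (R : Type) := gen_choiceMixin (fps R).

Section FpsRing.
Variable R : comNzRingType.
Implicit Types f g h : fps R.

Definition fadd f g := Fps (fun n => f n + g n).
Definition fopp f := Fps (fun n => - f n).
Definition fzero : fps R := Fps (fun=> 0).
Definition fmul f g := Fps (fun n => \sum_(j < n.+1) f j * g (n - j)%N).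
Definition fone : fps R := Fps (fun n => (n == 0)%:R).
Definition trunc N f : {poly R} := \poly_(i < N) f i.

Lemma faddA : associative fadd.
Proof. by move=> f g h; apply: fpsP => n /=; rewrite addrA. Qed.
Lemma faddC : commutative fadd.
Proof. by move=> f g; apply: fpsP => n /=; rewrite addrC. Qed.
Lemma fadd0 : left_id fzero fadd.
Proof. by move=> f; apply: fpsP => n /=; rewrite add0r. Qed.
Lemma faddN : left_inverse fzero fopp fadd.
Proof. by move=> f; apply: fpsP => n /=; rewrite addNr. Qed.

HB.instance Definition _ :=
  GRing.isZmodule.Build (fps R) faddA faddC fadd0 faddN.

(** Coefficient n of a product only sees coefficients up to n, so commutativity and associativity
    are inherited from polynomials by truncation. *)
Lemma coef_fmul_poly f g (p q : {poly R}) n :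
  (forall k, (k <= n)%N -> p`_k = f k) -> (forall k, (k <= n)%N -> q`_k = g k) ->
  (fmul f g) n = (p * q)`_n.
Proof.
move=> hp hq; rewrite coefM; apply: eq_bigr => j _.
by rewrite hp ?hq ?leq_subr // -ltnS.
Qed.

Lemma coef_trunc N f k : (k < N)%N -> (trunc N f)`_k = f k.
Proof. by move=> h; rewrite coef_poly h. Qed.

Lemma fmulC : commutative fmul.
Proof.
move=> f g; apply: fpsP => n.
rewrite (@coef_fmul_poly f g (trunc n.+1 f) (trunc n.+1 g)); last 2 first.
- by move=> k h; rewrite coef_trunc.
- by move=> k h; rewrite coef_trunc.
rewrite mulrC -(@coef_fmul_poly g f) // => k h; by rewrite coef_trunc.
Qed.

Lemma fmulA : associative fmul.
Proof.
move=> f g h; apply: fpsP => n.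
pose t x := trunc n.+1 x.
have ht x k : (k <= n)%N -> (t x)`_k = x k by move=> ?; rewrite coef_trunc.
have hp x y k : (k <= n)%N -> (t x * t y)`_k = (fmul x y) k.
  move=> hk; rewrite (@coef_fmul_poly _ _ (t x) (t y)) // => i hi;
  by rewrite ht // (leq_trans hi).
rewrite (@coef_fmul_poly f (fmul g h) (t f) (t g * t h)); [|exact: ht|exact: hp].
rewrite (@coef_fmul_poly (fmul f g) h (t f * t g) (t h)); [|exact: hp|exact: ht].
by rewrite mulrA.
Qed.

Lemma fmul1 : left_id fone fmul.
Proof.
move=> f; apply: fpsP => n /=.
by rewrite big_ord_recl /= mul1r subn0 big1 ?addr0 // => i _; rewrite mul0r.
Qed.

Lemma fmulDl : left_distributive fmul fadd.
Proof.
move=> f g h; apply: fpsP => n /=.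
by rewrite -big_split; apply: eq_bigr => i _; rewrite mulrDl.
Qed.

Lemma fone_neq0 : fone != fzero :> fps R.
Proof.
apply/eqP => /(congr1 (fun f : fps R => f 0)) /= /eqP.
by rewrite oner_eq0.
Qed.

HB.instance Definition _ :=
  GRing.Zmodule_isComNzRing.Build (fps R) fmulA fmulC fmul1 fmulDl fone_neq0.

Lemma fcoef0 n : (0 : fps R) n = 0. Proof. by []. Qed.
Lemma fcoef1 n : (1 : fps R) n = (n == 0)%:R. Proof. by []. Qed.
Lemma fcoefD f g n : (f + g) n = f n + g n. Proof. by []. Qed.
Lemma fcoefN f n : (- f) n = - f n. Proof. by []. Qed.
Lemma fcoefB f g n : (f - g) n = f n - g n. Proof. by []. Qed.
Lemma fcoefM f g n : (f * g) n = \sum_(j < n.+1) f j * g (n - j)%N.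
Proof. by []. Qed.
Lemma fcoefMn f k n : (f *+ k) n = f n *+ k.
Proof. by elim: k => [|k IH]; rewrite ?mulr0n // !mulrS fcoefD IH. Qed.
Lemma fcoef_natr k n : (k%:R : fps R) n = (if n == 0%N then k%:R else 0).
Proof. by rewrite fcoefMn fcoef1; case: n => [|n]; rewrite // mul0rn. Qed.
Lemma fcoef_sum (I : Type) (r : seq I) (P : pred I) (F : I -> fps R) n :
  (\sum_(i <- r | P i) F i) n = \sum_(i <- r | P i) F i n.
Proof. by elim/big_rec2: _ => // i y x _ <-. Qed.
Lemma fcoefM0 f g : (f * g) 0%N = f 0%N * g 0%N.
Proof. by rewrite fcoefM big_ord_recl big_ord0 addr0. Qed.
Lemma fcoefX0 f k : (f ^+ k) 0%N = f 0%N ^+ k.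
Proof. by elim: k => [|k IH] //; rewrite !exprS fcoefM0 IH. Qed.

Definition fC (c : R) : fps R := Fps (fun n => if n == 0%N then c else 0).
Lemma fcoefCM c f n : (fC c * f) n = c * f n.
Proof.
rewrite fcoefM big_ord_recl /= subn0 big1 ?addr0 // => i _.
by rewrite mul0r.
Qed.

Definition fX : fps R := Fps (fun n => (n == 1)%:R).
Lemma fcoefXM f n : (fX * f) n = if n is n'.+1 then f n' else 0.
Proof.
case: n => [|n]; first by rewrite fcoefM0 mul0r.
rewrite fcoefM big_ord_recl /= mul0r add0r big_ord_recl /= mul1r subn1 /=.
by rewrite big1 ?addr0 // => i _; rewrite mul0r.
Qed.
Lemma fcoefXnM f k n : (fX ^+ k * f) n = if (k <= n)%N then f (n - k)%N else 0.
Proof.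
elim: k n => [|k IH] n; first by rewrite mul1r subn0.
by rewrite exprS -mulrA fcoefXM; case: n => // n; rewrite IH ltnS.
Qed.
Lemma fcoefXn k n : (fX ^+ k) n = (n == k)%:R.
Proof.
rewrite -[fX ^+ k]mulr1 fcoefXnM fcoef1 subn_eq0.
by rewrite eqn_leq; case: leqP; rewrite ?andbF ?andbT.
Qed.

Definition feqm N f g := forall n, (n < N)%N -> f n = g n.

Lemma feqm_refl N f : feqm N f f. Proof. by []. Qed.
Lemma feqm_sym N f g : feqm N f g -> feqm N g f.
Proof. by move=> h n /h. Qed.
Lemma feqm_trans N f g h : feqm N f g -> feqm N g h -> feqm N f h.
Proof. by move=> h1 h2 n hn; rewrite h1 ?h2. Qed.
Lemma feqm_leq M N f g : (M <= N)%N -> feqm N f g -> feqm M f g.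
Proof. by move=> h1 h2 n hn; apply: h2; apply: leq_trans h1. Qed.
Lemma feqmD N f g f' g' : feqm N f f' -> feqm N g g' -> feqm N (f + g) (f' + g').
Proof. by move=> h1 h2 n hn; rewrite !fcoefD h1 ?h2. Qed.
Lemma feqmN N f f' : feqm N f f' -> feqm N (- f) (- f').
Proof. by move=> h1 n hn; rewrite !fcoefN h1. Qed.
Lemma feqmM N f g f' g' : feqm N f f' -> feqm N g g' -> feqm N (f * g) (f' * g').
Proof.
move=> h1 h2 n hn; rewrite !fcoefM; apply: eq_bigr => i _.
by rewrite h1 ?h2 // (leq_ltn_trans _ hn) ?leq_subr // -ltnS.
Qed.
Lemma feqmX N f f' k : feqm N f f' -> feqm N (f ^+ k) (f' ^+ k).
Proof. by move=> h; elim: k => [|k IH] //; rewrite !exprS; apply: feqmM. Qed.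
Lemma feqm_eq f g : (forall N, feqm N f g) -> f = g.
Proof. by move=> h; apply: fpsP => n; apply: (h n.+1). Qed.

Lemma feqm_lowM a b f g : feqm a f 0 -> feqm b g 0 -> feqm (a + b) (f * g) 0.
Proof.
move=> hf hg n hn; rewrite fcoefM fcoef0 big1 // => i _.
case: (ltnP i a) => hi; first by rewrite hf // mul0r.
by have hi2 := ltn_ord i; rewrite hg ?fcoef0 ?mulr0 //; lia.
Qed.
Lemma fcoef_leadM a b f g : feqm a f 0 -> feqm b g 0 ->
  (f * g) (a + b)%N = f a * g b.
Proof.
move=> hf hg; rewrite fcoefM.
have ha : (a < (a + b).+1)%N by lia.
rewrite (bigD1 (Ordinal ha)) //= addKn big1 ?addr0 // => i hi.
have {}hi : (i : nat) != a by apply: contra hi => /eqP hi; apply/eqP/val_inj.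
case: (ltnP i a) => hia; first by rewrite hf // mul0r.
by have hi2 := ltn_ord i; rewrite hg ?fcoef0 ?mulr0 //; lia.
Qed.
Lemma feqm_lowX f k : f 0%N = 0 -> feqm k (f ^+ k) 0.
Proof.
move=> h; elim: k => [|k IH] //; rewrite exprS -[k.+1]add1n.
by apply: feqm_lowM => // -[].
Qed.
Lemma feqm_lowM1 b f g : feqm b g 0 -> feqm b (f * g) 0.
Proof. by move=> h; apply: (@feqm_lowM 0 b). Qed.

(* The derivation X d/dX. *)
Definition fD f := Fps (fun n => f n *+ n).
Lemma fDD f g : fD (f + g) = fD f + fD g.
Proof. by apply: fpsP => n /=; rewrite mulrnDl. Qed.
Lemma fDN f : fD (- f) = - fD f.
Proof. by apply: fpsP => n /=; rewrite mulNrn. Qed.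
Lemma fDM f g : fD (f * g) = fD f * g + f * fD g.
Proof.
apply: fpsP => n; rewrite fcoefD !fcoefM /= -big_split -sumrMnl.
apply: eq_bigr => i _ /=; rewrite mulrnAl mulrnAr -mulrnDr subnKC //.
by rewrite -ltnS.
Qed.
Lemma fD1 : fD 1 = 0.
Proof. by apply: fpsP => -[|n] /=; rewrite ?mul0rn ?mulr0n. Qed.
Lemma fDMn f k : fD (f *+ k) = fD f *+ k.
Proof. by apply: fpsP => n; rewrite fcoefMn /= fcoefMn mulrnAC. Qed.
Lemma fDnat k : fD k%:R = 0.
Proof. by rewrite fDMn fD1 mul0rn. Qed.
Lemma fDX f k : fD (f ^+ k.+1) = k.+1%:R * f ^+ k * fD f.
Proof.
elim: k => [|k IH]; first by rewrite expr1 expr0 !mul1r.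
by rewrite exprS fDM IH exprS (natrD _ 1 k.+1); ring.
Qed.
Lemma fDfX : fD fX = fX.
Proof. by apply: fpsP => -[|[|n]] //=; rewrite mul0rn. Qed.
Lemma fD_low N f : feqm N f 0 -> feqm N (fD f) 0.
Proof. by move=> h n hn; rewrite /= h // fcoef0 mul0rn. Qed.

(* The substitution X |-> X^d. *)
Definition dilate d f := Fps (fun n => if (d %| n)%N then f (n %/ d)%N else 0).

Lemma fcoef_dilate d f n :
  (dilate d f) n = if (d %| n)%N then f (n %/ d)%N else 0.
Proof. by []. Qed.
Lemma dilate1 d : (0 < d)%N -> dilate d 1 = 1.
Proof.
move=> d0; apply: fpsP => n; rewrite fcoef_dilate !fcoef1.
case: ifP => [/dvdnP [k ->]|hn]; first by rewrite mulnK // muln_eq0 (gtn_eqF d0) orbF.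
by case: eqP hn => // ->; rewrite dvdn0.
Qed.
Lemma dilateD d f g : dilate d (f + g) = dilate d f + dilate d g.
Proof. by apply: fpsP => n /=; case: ifP; rewrite ?addr0. Qed.
Lemma dilateN d f : dilate d (- f) = - dilate d f.
Proof. by apply: fpsP => n /=; case: ifP; rewrite ?oppr0. Qed.
Lemma dilateM d f g : (0 < d)%N -> dilate d (f * g) = dilate d f * dilate d g.
Proof.
move=> d0; apply: fpsP => n.
pose t x := trunc n.+1 x \Po 'X^d.
have ht x k : (k <= n)%N -> (t x)`_k = dilate d x k.
  move=> hk; rewrite coef_comp_poly_Xn //=; case: ifP => // hd.
  by rewrite coef_trunc // ltnS (leq_trans _ hk) ?leq_div.
rewrite [RHS](@coef_fmul_poly _ _ (t f) (t g)); [|exact: ht|exact: ht].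
rewrite -comp_polyM coef_comp_poly_Xn //=; case: ifP => // hd.
by apply: coef_fmul_poly => k hk; rewrite coef_trunc // ltnS (leq_trans hk) ?leq_div.
Qed.
Lemma dilateX d f k : (0 < d)%N -> dilate d (f ^+ k) = dilate d f ^+ k.
Proof.
by move=> d0; elim: k => [|k IH]; rewrite ?expr0 ?dilate1 // !exprS dilateM // IH.
Qed.
Lemma dilateMn d f k : dilate d (f *+ k) = dilate d f *+ k.
Proof. by apply: fpsP => n; rewrite fcoefMn /= fcoefMn; case: ifP; rewrite ?mul0rn. Qed.
Lemma dilate_nat d k : (0 < d)%N -> dilate d k%:R = k%:R.
Proof. by move=> d0; rewrite dilateMn dilate1. Qed.
Lemma dilatefX d : (0 < d)%N -> dilate d fX = fX ^+ d.
Proof.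
move=> d0; apply: fpsP => n; rewrite fcoefXn /=.
case: ifP => [/dvdnP [k ->]|hd].
  by rewrite mulnK // -{2}[d]mul1n eqn_pmul2r.
by case: eqP => // hn; rewrite hn dvdnn in hd.
Qed.
Lemma fD_dilate d f : (0 < d)%N -> fD (dilate d f) = d%:R * dilate d (fD f).
Proof.
move=> d0; apply: fpsP => n.
rewrite mulr_natl fcoefMn /=; case: ifP => [/dvdnP [k ->]|_]; rewrite ?mul0rn //.
by rewrite mulnK // mulrnA.
Qed.
Lemma dilate0 d f : (dilate d f) 0%N = f 0%N.
Proof. by rewrite /= dvdn0 div0n. Qed.
Lemma dilate_mulr d f n : (0 < d)%N -> (dilate d f) (d * n)%N = f n.
Proof. by move=> d0; rewrite /= dvdn_mulr // mulKn. Qed.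
Lemma dilateA c d f : (0 < c)%N -> (0 < d)%N -> dilate c (dilate d f) = dilate (c * d) f.
Proof.
move=> c0 d0; apply: fpsP => n /=; case: (boolP (c %| n)%N) => [/dvdnP [k ->]|hc].
  by rewrite mulnK // [(k * c)%N]mulnC dvdn_pmul2l // divnMl.
case: ifP => // /(dvdn_trans (dvdn_mulr d (dvdnn c))).
by rewrite (negPf hc).
Qed.
Lemma dilate_id f : dilate 1 f = f.
Proof. by apply: fpsP => n /=; rewrite dvd1n divn1. Qed.
Lemma feqm_dilate d N f g : (0 < d)%N -> feqm N f g ->
  feqm (d * N) (dilate d f) (dilate d g).
Proof.
move=> d0 h n hn /=; case: ifP => // hd; apply: h.
by rewrite ltn_divLR // mulnC.
Qed.
Lemma dilate_0 d : dilate d 0 = 0.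
Proof. by apply: fpsP => n /=; case: ifP. Qed.

(** [c] stands for the inverse of the constant term. In degree n the geometric series may stop at k
    = n, because 1 - c f then has no constant term. *)
Definition finv_of (c : R) f : fps R :=
  Fps (fun n => c * (\sum_(k < n.+1) (1 - fC c * f) ^+ k) n).

Lemma finv_ofP c f : c * f 0%N = 1 -> f * finv_of c f = 1.
Proof.
move=> hc; apply: feqm_eq => N; set u := 1 - fC c * f.
have u0 : u 0%N = 0 by rewrite fcoefB fcoefCM hc fcoef1 subrr.
have h : feqm N (finv_of c f) (fC c * \sum_(k < N) u ^+ k).
  move=> n hn; rewrite fcoefCM /=; congr (_ * _).
  rewrite !fcoef_sum -!(big_mkord xpredT (fun k => (u ^+ k) n)).
  rewrite [RHS](@big_cat_nat _ _ _ n.+1) //= [X in _ = _ + X]big1_seq ?addr0 //.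
  move=> k; rewrite mem_index_iota => /andP [_ /andP [hk _]].
  exact: feqm_lowX u0 _ hk.
apply: feqm_trans (feqmM (@feqm_refl _ f) h) _.
rewrite mulrA [f * _]mulrC.
have -> : fC c * f = 1 - u by rewrite /u; ring.
have -> : (1 - u) * (\sum_(k < N) u ^+ k) = 1 - u ^+ N.
  by rewrite -[LHS]opprK -mulNr opprB -subrX1 opprB.
rewrite -{2}[1 : fps R]subr0; apply: feqmD => //.
by apply: feqmN; apply: feqm_lowX.
Qed.

Definition fpoly (p : {poly R}) : fps R := Fps (fun n => p`_n).
Lemma fpoly1 : fpoly 1 = 1.
Proof. by apply: fpsP => n /=; rewrite coef1. Qed.
Lemma fpolyD p q : fpoly (p + q) = fpoly p + fpoly q.
Proof. by apply: fpsP => n /=; rewrite coefD. Qed.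
Lemma fpolyN p : fpoly (- p) = - fpoly p.
Proof. by apply: fpsP => n /=; rewrite coefN. Qed.
Lemma fpolyM p q : fpoly (p * q) = fpoly p * fpoly q.
Proof. by apply: fpsP => n; rewrite /= coefM. Qed.
Lemma fpolyXn k : fpoly 'X^k = fX ^+ k.
Proof. by apply: fpsP => n; rewrite fcoefXn /= coefXn. Qed.
Lemma fpolyX p k : fpoly (p ^+ k) = fpoly p ^+ k.
Proof. by elim: k => [|k IH]; rewrite ?expr0 ?fpoly1 // !exprS fpolyM IH. Qed.
Lemma fpoly0 : fpoly 0 = 0.
Proof. by apply: fpsP => n /=; rewrite coef0. Qed.
Lemma fpoly_prod (I : Type) (r : seq I) (P : pred I) (F : I -> {poly R}) :
  fpoly (\prod_(i <- r | P i) F i) = \prod_(i <- r | P i) fpoly (F i).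
Proof. exact: (big_morph _ fpolyM fpoly1). Qed.
Lemma fpoly_sum (I : Type) (r : seq I) (P : pred I) (F : I -> {poly R}) :
  fpoly (\sum_(i <- r | P i) F i) = \sum_(i <- r | P i) fpoly (F i).
Proof. exact: (big_morph _ fpolyD fpoly0). Qed.

End FpsRing.
Arguments fX {R}.

Section FpsUnit.
Variable R : comUnitRingType.
Implicit Types f g : fps R.

Definition funit : pred (fps R) := fun f => f 0%N \is a GRing.unit.
Definition finv f := if funit f then finv_of (f 0%N)^-1 f else f.

Lemma fmulVr : {in funit, left_inverse 1 finv *%R}.
Proof.
move=> f hf; rewrite /finv; have -> : funit f by [].
by rewrite mulrC finv_ofP // mulVr.
Qed.
Lemma funitPl f g : g * f = 1 -> funit f.
Proof.
move=> /(congr1 (fun h : fps R => h 0%N)); rewrite fcoefM0 fcoef1 => h.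
by apply/unitrPr; exists (g 0%N); rewrite mulrC.
Qed.
Lemma finv_out : {in [predC funit], finv =1 id}.
Proof.
by move=> f hf; rewrite /finv ifF //; apply/negbTE: hf.
Qed.

HB.instance Definition _ :=
  GRing.ComNzRing_hasMulInverse.Build (fps R) fmulVr funitPl finv_out.

Lemma funitE f : (f \is a GRing.unit) = (f 0%N \is a GRing.unit).
Proof. by []. Qed.
Lemma funit1 f : f 0%N = 1 -> f \is a GRing.unit.
Proof. by rewrite funitE => ->; rewrite unitr1. Qed.
End FpsUnit.

(** The lowest nonzero terms multiply. Integrality allows later identities to be proved after
    multiplication by a nonzero series. *)
Lemma fps_mulf_eq0 (R : idomainType) (f g : fps R) :
  f * g = 0 -> (f == 0) || (g == 0).
Proof.
have lead (h : fps R) : h <> 0 -> exists a, feqm a h 0 /\ h a != 0.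
  move=> hn; have ex : exists a, h a != 0.
    apply: contrapT => hh; apply: hn; apply: fpsP => n; apply: contrapT => hx.
    by apply: hh; exists n; apply/eqP.
  exists (ex_minn ex); case: ex_minnP => a ha hmin; split=> // n hna.
  by apply: contrapT => /eqP hx; have := hmin n hx; rewrite leqNgt hna.
move=> h; apply: contrapT => /negP; rewrite negb_or => /andP [/eqP hf /eqP hg].
have [[a [ha /negP ha']] [b [hb hb']]] := (lead f hf, lead g hg).
apply: ha'; have := fcoef_leadM ha hb; rewrite h fcoef0 => /esym/eqP.
by rewrite mulf_eq0 (negPf hb') orbF.
Qed.
HB.instance Definition _ (R : idomainType) :=
  GRing.ComUnitRing_isIntegral.Build (fps R) (@fps_mulf_eq0 R).

(** * Theta series and sums of two squares *)

Definition zbox K : seq int := [seq i%:Z - K%:Z | i <- iota 0 K.*2.+1].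

Arguments zbox : simpl never.

Lemma mem_zbox K (a : int) : (a \in zbox K) = (`|a| <= K)%N.
Proof.
apply/mapP/idP => [[i]|ha]; first by rewrite mem_iota => hi ->; lia.
by exists (absz (a + K%:Z)); [rewrite mem_iota; lia|lia].
Qed.

Lemma uniq_zbox K : uniq (zbox K).
Proof. by rewrite map_inj_uniq ?iota_uniq // => i j /addIr [->]. Qed.

Lemma sqr_boxed (a : int) (K N : nat) : a * a <= N%:Z -> (N <= K)%N -> a \in zbox K.
Proof. by rewrite mem_zbox => h1 h2; nia. Qed.

Definition sqrt_ints N := [seq a <- zbox N | a * a == N%:Z].
Definition two_squares N :=
  [seq x <- [seq (a, b) | a <- zbox N, b <- zbox N] | x.1 * x.1 + x.2 * x.2 == N%:Z].

Arguments sqrt_ints : simpl never.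
Arguments two_squares : simpl never.

Definition theta1 (w : int -> int) : fps int := Fps (fun N => \sum_(a <- sqrt_ints N) w a).
Definition theta2 (W : int -> int -> int) : fps int :=
  Fps (fun N => \sum_(x <- two_squares N) W x.1 x.2).

Lemma mem_two_squares N (x : int * int) :
  (x \in two_squares N) = (x.1 * x.1 + x.2 * x.2 == N%:Z).
Proof.
rewrite mem_filter; apply: andb_idr => /eqP h.
case: x h => a b h; apply/allpairsPdep; exists a, b.
by move: h => /= h; split=> //; apply: (@sqr_boxed _ N N) => //; nia.
Qed.

Lemma uniq_two_squares N : uniq (two_squares N).
Proof.
apply: filter_uniq; apply: allpairs_uniq; rewrite ?uniq_zbox //.
by move=> [a b] [c d].
Qed.

(** A box common to all indices up to K lets sums over different indices be interchanged. *)
Lemma theta1_box w N K : (N <= K)%N ->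
  theta1 w N = \sum_(a <- zbox K) (if a * a == N%:Z then w a else 0).
Proof.
move=> hK; rewrite -big_mkcond /= -[RHS]big_filter [LHS]/=; apply: perm_big.
apply: uniq_perm; rewrite ?filter_uniq ?uniq_zbox // => a.
rewrite !mem_filter; case: eqP => //= h.
by rewrite !(@sqr_boxed _ _ N) //; rewrite h.
Qed.

Lemma theta1_mul w w' : theta1 w * theta1 w' = theta2 (fun a b => w a * w' b).
Proof.
apply: fpsP => N; rewrite fcoefM [RHS]/=.
rewrite /two_squares [RHS]big_filter [RHS]big_mkcond [RHS]big_allpairs_dep [RHS]/=.
transitivity (\sum_(i < N.+1) \sum_(a <- zbox N) \sum_(b <- zbox N)
    (if a * a == i%:Z then w a else 0) *
    (if b * b == (N - i)%N%:Z then w' b else 0)).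
  apply: eq_bigr => i _.
  by rewrite (@theta1_box w i N) -1?ltnS // (@theta1_box w' (N - i)%N N) ?leq_subr // big_distrlr.
rewrite exchange_big /=; apply: eq_bigr => a _.
rewrite exchange_big /=; apply: eq_bigr => b _.
(* For a fixed pair (a, b) only the index i = a^2 can contribute, and only if a^2 + b^2 = N. *)
case: eqP => [h|h]; last first.
  apply: big1 => i _; case: eqP => h1; rewrite ?mul0r //.
  case: eqP => h2; rewrite ?mulr0 //; exfalso; apply: h.
  by have hi := ltn_ord i; rewrite h1 h2; lia.
have ha : (absz (a * a)%R < N.+1)%N by nia.
rewrite (bigD1 (Ordinal ha)) //= [X in _ + X]big1 ?addr0.
  by rewrite !ifT //; apply/eqP; nia.
move=> i hi; rewrite ifF ?mul0r //; apply/eqP => h1.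
by move/eqP: hi; apply; apply: val_inj => /=; lia.
Qed.

Lemma theta2_ext W W' : (forall a b, W a b = W' a b) -> theta2 W = theta2 W'.
Proof. by move=> h; apply: fpsP => N /=; apply: eq_bigr => x _; rewrite h. Qed.

Lemma theta2D W W' : theta2 W + theta2 W' = theta2 (fun a b => W a b + W' a b).
Proof. by apply: fpsP => N; rewrite fcoefD /= -big_split. Qed.

Lemma theta2N W : - theta2 W = theta2 (fun a b => - W a b).
Proof. by apply: fpsP => N; rewrite fcoefN /= -sumrN. Qed.

Lemma theta2Mn W k : theta2 W *+ k = theta2 (fun a b => W a b *+ k).
Proof. by apply: fpsP => N; rewrite fcoefMn /= -sumrMnl. Qed.

Lemma theta2_inv (phi : int * int -> int * int) W :
  injective phi ->
  (forall x, (phi x).1 * (phi x).1 + (phi x).2 * (phi x).2 =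
             x.1 * x.1 + x.2 * x.2) ->
  (forall y, exists x, phi x = y) ->
  theta2 W = theta2 (fun a b => W (phi (a, b)).1 (phi (a, b)).2).
Proof.
move=> hinj hn hs; apply: fpsP => N /=.
transitivity (\sum_(x <- map phi (two_squares N)) W x.1 x.2); last first.
  by rewrite big_map; apply: eq_bigr => -[a b].
apply: perm_big; apply: uniq_perm; rewrite ?map_inj_uniq ?uniq_two_squares // => y.
have [x <-] := hs y.
by rewrite mem_map // !mem_two_squares hn.
Qed.

Lemma theta2_swap W : theta2 W = theta2 (fun a b => W b a).
Proof.
apply: (@theta2_inv (fun x => (x.2, x.1))) => [[a b] [c d] /= [-> ->]|[a b]|[a b]] //=.
  by rewrite addrC.
by exists (b, a).
Qed.

Lemma theta2_negl W : theta2 W = theta2 (fun a b => W (- a) b).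
Proof.
apply: (@theta2_inv (fun x => (- x.1, x.2))) => [[a b] [c d] /= [/oppr_inj -> ->]|[a b]|[a b]] //=.
  by rewrite mulrNN.
by exists (- a, b); rewrite /= opprK.
Qed.

Definition evenz (a : int) := (2 %| a)%Z.

(* The rotation (u, v) |-> (u + v, u - v) doubles u^2 + v^2 and reaches exactly
   the pairs of equal parity. *)
Lemma theta2_rot W :
  dilate 2 (theta2 W) =
  theta2 (fun a b => if evenz (a - b) then W ((a + b) %/ 2)%Z ((a - b) %/ 2)%Z else 0).
Proof.
apply: fpsP => N; rewrite fcoef_dilate; case: ifP => [/dvdnP [M ->]|hN]; last first.
  rewrite /= big_seq big1 // => -[a b]; rewrite mem_two_squares /= => /eqP h.
  rewrite /evenz ifF //; apply: contraFF hN => /dvdzP [c hc].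
  apply/dvdnP; exists (absz (2 * c * c + 2 * c * b + b * b)).
  have {}hc : a = b + c * 2 by lia.
  set e := 2 * c * c + 2 * c * b + b * b.
  have he : N%:Z = e * 2 by rewrite -h hc /e; ring.
  have e0 : 0 <= e.
    have -> : e = c * c + (c + b) * (c + b) by rewrite /e; ring.
    by rewrite -!expr2 addr_ge0 ?sqr_ge0.
  lia.
rewrite mulnK //=.
pose rho (x : int * int) := (x.1 + x.2, x.1 - x.2).
transitivity (\sum_(x <- map rho (two_squares M))
   (if evenz (x.1 - x.2) then W ((x.1 + x.2) %/ 2)%Z ((x.1 - x.2) %/ 2)%Z else 0)).
  rewrite big_map; apply: eq_bigr => -[a b] _ /=.
  have -> : a + b - (a - b) = b * 2 by ring.
  have -> : a + b + (a - b) = a * 2 by ring.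
  by rewrite /evenz dvdz_mull // !mulzK.
apply: perm_big; apply: uniq_perm; rewrite ?uniq_two_squares //.
  rewrite map_inj_uniq ?uniq_two_squares // => -[a b] [c d] [h1 h2].
  by congr (_, _); lia.
move=> [a b]; rewrite mem_two_squares /=; apply/mapP/eqP => [[[u v]]|h].
  by rewrite mem_two_squares /= => /eqP h [-> ->]; nia.
(* Here (a - b)^2 = 2 (M - a b). *)
have hab : (2 %| a - b)%Z.
  have : (2 %| (a - b) * (a - b))%Z.
    apply/dvdzP; exists (M%:Z - a * b); nia.
  by rewrite !dvdzE abszM Euclid_dvdM // orbb.
case/dvdzP: hab => c hc.
exists (b + c, c); last by rewrite /rho /=; congr pair; lia.
rewrite mem_two_squares /=; have {}hc : a = b + c * 2 by lia.
by rewrite hc in h; apply/eqP; nia.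
Qed.

Definition signz (a : int) : int := if evenz a then 1 else -1.
Definition phi_p : fps int := theta1 (fun=> 1).
Definition phi_m : fps int := theta1 signz.
(* Each odd m > 0 occurs once, with the sign that makes it 1 mod 4. *)
Definition jacobi_ser : fps int := theta1 (fun a => if (a %% 4)%Z == 1 then a else 0).

Lemma theta2_eq0 W : theta2 W = - theta2 W -> theta2 W = 0.
Proof.
move=> h; have : theta2 W *+ 2 = 0 by rewrite mulr2n {2}h subrr.
move=> h2; apply: fpsP => n; have := congr1 (fun f : fps int => f n) h2.
by rewrite fcoefMn => /eqP; rewrite mulrn_eq0 => /eqP.
Qed.

(** Arithmetic mean step: the weight 1 + (-1)^(a+b) is 2 on the pairs of equal parity, which are
    those reached by the rotation, and 0 on the others. *)
Lemma phi_sqD : phi_p ^+ 2 + phi_m ^+ 2 = 2%:R * dilate 2 phi_p ^+ 2.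
Proof.
rewrite -[dilate 2 _ ^+ 2]dilateX // mulr_natl !expr2 !theta1_mul theta2_rot theta2D theta2Mn.
apply: theta2_ext => a b; rewrite /signz /evenz.
by do ?[case: ifP => ?]; lia.
Qed.

(** Geometric mean step: on pairs of equal parity both sides have weight (-1)^b; on the other pairs
    (-1)^b changes sign when a and b are swapped, so their total vanishes. *)
Lemma phi_mul : phi_p * phi_m = dilate 2 phi_m ^+ 2.
Proof.
rewrite -[dilate 2 _ ^+ 2]dilateX // !expr2 !theta1_mul theta2_rot.
apply/eqP; rewrite -subr_eq0; apply/eqP; rewrite theta2N theta2D.
rewrite (@theta2_ext _ (fun a b => if evenz (a - b) then 0 else signz b)).
  apply: theta2_eq0; apply: etrans (theta2_swap _) _; rewrite theta2N.
  apply: theta2_ext => a b; rewrite /signz /evenz.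
  by do ?[case: ifP => ?]; lia.
move=> a b; rewrite /signz /evenz.
by do ?[case: ifP => ?]; lia.
Qed.

Lemma fD_theta1 w : fD (theta1 w) = theta1 (fun a => a * a * w a).
Proof.
apply: fpsP => N /=; rewrite -sumrMnl big_seq [RHS]big_seq.
apply: eq_bigr => a; rewrite mem_filter => /andP [/eqP -> _].
by rewrite -mulr_natl natz.
Qed.

(** The right-hand side has weight (a^2 - b^2) (-1)^b before dilation; the rotation turns a^2 - b^2
    into the product a b. Averaging over signs then kills the even pairs and leaves a b chi(a)
    chi(b), a product weight. *)
Lemma jacobi_ser_sqr :
  4%:R * jacobi_ser ^+ 2 = dilate 2 (phi_m * fD phi_p - phi_p * fD phi_m).
Proof.
rewrite [phi_m * _]mulrC !fD_theta1 expr2 !theta1_mul theta2N theta2D theta2_rot.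
set W := fun a b : int => _; set V := fun a b : int => _.
have sym (U : int -> int -> int) : theta2 U *+ 4 =
  theta2 (fun a b => U a b + U (- a) b + (U a (- b) + U (- a) (- b))).
  rewrite -!theta2D; have e1 := theta2_negl U.
  have e2 : theta2 U = theta2 (fun a b => U a (- b)).
    by apply: etrans (theta2_swap _) _; apply: etrans (theta2_negl _) _; apply: theta2_swap.
  have e3 : theta2 U = theta2 (fun a b => U (- a) (- b)).
    by apply: etrans e2 _; apply: theta2_negl.
  by rewrite -e1 -e2 -e3; ring.
pose V' a b : int := if evenz (a - b) then a * b * signz ((a - b) %/ 2)%Z else 0.
have -> : theta2 V = theta2 V'.
  apply: theta2_ext => a b; rewrite /V /V'; case: ifP => // /dvdzP [c hc].
  have {}hc : a = b + c * 2 by rewrite -hc; ring.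
  have -> : a + b = (b + c) * 2 by rewrite hc; ring.
  have -> : a - b = c * 2 by rewrite hc; ring.
  by rewrite !mulzK // hc; ring.
(* The nontrivial character modulo 4; a chi(a) is the sum of the weight of [jacobi_ser] over a and
   -a. *)
pose chi (a : int) : int := if (a %% 4)%Z == 1 then 1 else if (a %% 4)%Z == 3 then -1 else 0.
pose o (a : int) : int := if (a %% 4)%Z == 1 then a else 0.
have hV a b : V' a b + V' (- a) b = a * b * (chi a * chi b) *+ 2.
  rewrite /V' /signz /evenz /chi.
  by do ?[case: ifP => ?]; lia.
have ho a : o a + o (- a) = a * chi a by rewrite /o /chi; do ?[case: ifP => ?]; lia.
have chiN a : chi (- a) = - chi a by rewrite /chi; do ?[case: ifP => ?]; lia.
have h : (4%:R * theta2 W) *+ 4 = theta2 V' *+ 4.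
  rewrite mulr_natl (sym W) (sym V') theta2Mn; apply: theta2_ext => a b.
  rewrite !hV chiN; transitivity ((o a + o (- a)) * (o b + o (- b)) *+ 4).
    by rewrite /W /o; ring.
  by rewrite !ho; ring.
apply: fpsP => n; have := congr1 (fun f : fps int => f n) h.
by rewrite !(fcoefMn _ 4) => /eqP; rewrite eqr_pMn2r // => /eqP.
Qed.

(** * Theta functions as infinite products *)

Lemma fcoefM1 (R : comNzRingType) (f g : fps R) :
  (f * g) 1%N = f 0%N * g 1%N + f 1%N * g 0%N.
Proof. by rewrite fcoefM big_ord_recl big_ord_recl big_ord0 addr0. Qed.

Lemma fD_0 (R : comNzRingType) (f : fps R) : (fD f) 0%N = 0.
Proof. exact: mulr0n. Qed.
Lemma fD_1 (R : comNzRingType) (f : fps R) : (fD f) 1%N = f 1%N.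
Proof. exact: mulr1n. Qed.

Lemma sqrt_ints0 : sqrt_ints 0 = [:: 0]. Proof. by []. Qed.
Lemma sqrt_ints1 : sqrt_ints 1 = [:: -1; 1]. Proof. by []. Qed.

Lemma phi_p0 : phi_p 0%N = 1.
Proof. by rewrite /phi_p /theta1 [LHS]/= sqrt_ints0 big_seq1. Qed.
Lemma phi_p1 : phi_p 1%N = 2.
Proof. by rewrite /phi_p /theta1 [LHS]/= sqrt_ints1 big_cons big_seq1. Qed.
Lemma phi_m0 : phi_m 0%N = 1.
Proof. by rewrite /phi_m /theta1 [LHS]/= sqrt_ints0 big_seq1. Qed.
Lemma phi_m1 : phi_m 1%N = -2.
Proof. by rewrite /phi_m /theta1 [LHS]/= sqrt_ints1 big_cons big_seq1. Qed.
Lemma jacobi_ser1 : jacobi_ser 1%N = 1.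
Proof. by rewrite /jacobi_ser /theta1 [LHS]/= sqrt_ints1 big_cons big_seq1. Qed.

(** If e had order n >= 2, the left-hand side would have order at least 2 n, but the right-hand side
    has order exactly n + 1. So a functional equation relating X and X^2 determines a series from
    its first two coefficients. *)
Lemma dilate2_contract (c d e : fps int) :
  c * dilate 2 e = d * e -> d 0%N = 0 -> d 1%N != 0 -> e 0%N = 0 -> e 1%N = 0 ->
  e = 0.
Proof.
move=> h d0 d1 e0 e1; suff low n : feqm n e 0 by apply: feqm_eq.
elim: n => [|n IH] // m; rewrite ltnS leq_eqVlt => /orP [/eqP -> |]; last exact: IH.
case: (ltnP n 2) => hn.
  by case: n hn {IH} => [|[|n]] //.
have hd : feqm 1 d 0 by case.
have lowE : feqm (2 * n) (dilate 2 e) 0 by rewrite -(dilate_0 _ 2); apply: feqm_dilate.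
have := fcoef_leadM hd IH; rewrite -h (feqm_lowM1 c lowE); last by lia.
by rewrite fcoef0 => /esym/eqP; rewrite mulf_eq0 (negPf d1) /= => /eqP.
Qed.

Local Notation f0 := phi_p.
Local Notation h0 := phi_m.
Local Notation f1 := (dilate 2 phi_p).
Local Notation h1 := (dilate 2 phi_m).

Lemma fD_sqr (f : fps int) : fD (f ^+ 2) = 2 * (f * fD f).
Proof. by rewrite fDX expr1; ring. Qed.

(** In Jacobi's notation this is 2 theta_2(X^2)^2. It has a simple zero, as [dilate2_contract]
    requires of its factor [d]. *)
Definition phi_gap : fps int := f0 ^+ 2 - h0 ^+ 2.
Lemma phi_gap0 : phi_gap 0%N = 0.
Proof. by rewrite fcoefB !fcoefX0 phi_p0 phi_m0. Qed.
Lemma phi_gap1 : phi_gap 1%N = 8.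
Proof. by rewrite fcoefB !expr2 !fcoefM1 phi_p0 phi_m0 phi_p1 phi_m1. Qed.

(* By the AGM relations phi_sqD and phi_mul, both sides are multiplied by the
   same factor under X |-> X^2; as they agree modulo X^2, they are equal. *)
Lemma phi_wronskian :
  4 * (h0 * fD f0 - f0 * fD h0) = f0 * h0 * (f0 ^+ 4 - h0 ^+ 4).
Proof.
set A := LHS; set B := RHS.
have e1 : 2 * f1 ^+ 2 = f0 ^+ 2 + h0 ^+ 2 by rewrite phi_sqD.
have e2 : h1 ^+ 2 = f0 * h0 by rewrite phi_mul.
have e3 : 4 * (f1 * dilate 2 (fD f0)) = f0 * fD f0 + h0 * fD h0.
  have := congr1 (@fD _) e1; rewrite fDM fDnat mul0r add0r fDD !fD_sqr fD_dilate //.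
  rewrite -mulrDr => /mulfI; rewrite -[2%:R]/(2%:R : fps int) => h; rewrite -h.
    by ring.
  by apply/eqP => /(congr1 (fun f : fps int => f 0%N)).
have e4 : 4 * (h1 * dilate 2 (fD h0)) = f0 * fD h0 + h0 * fD f0.
  have := congr1 (@fD _) e2; rewrite fD_sqr fDM fD_dilate // => h.
  by rewrite [RHS]addrC [h0 * _]mulrC -h; ring.
suff : A - B = 0 by move/eqP; rewrite subr_eq0 => /eqP.
apply: (@dilate2_contract (8 * (f1 * h1)) phi_gap); rewrite ?phi_gap0 ?phi_gap1 //.
- have sA : 8 * (f1 * h1) * dilate 2 A = phi_gap * A.
    rewrite /A !(dilateM, dilateD, dilateN, dilate_nat) //.
    transitivity (8 * (h1 ^+ 2 * (4 * (f1 * dilate 2 (fD f0))))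
       - 4 * (2 * f1 ^+ 2 * (4 * (h1 * dilate 2 (fD h0))))); first by ring.
    by rewrite e1 e2 e3 e4 /phi_gap; ring.
  have sB : 8 * (f1 * h1) * dilate 2 B = phi_gap * B.
    rewrite /B !(dilateM, dilateD, dilateN, dilate_nat, dilateX) //.
    transitivity (h1 ^+ 2 * (2 * f1 ^+ 2) *
       ((2 * f1 ^+ 2) ^+ 2 - 4 * (h1 ^+ 2) ^+ 2)); first by ring.
    by rewrite e1 e2 /phi_gap; ring.
  by rewrite dilateD dilateN mulrDr mulrN sA sB; ring.
- rewrite fcoefB /A /B !(fcoefM0, fcoefB, fcoefX0, fD_0).
  by rewrite phi_p0 phi_m0.
- rewrite fcoefB /A /B !(exprS, expr0) !(fcoefM1, fcoefM0, fcoefB, fcoefX0, fD_0, fD_1).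
  by rewrite phi_p0 phi_m0 phi_p1 phi_m1.
Qed.

Definition euler_trunc N : fps int := \prod_(1 <= k < N.+1) (1 - fX ^+ k).
Definition euler_prod : fps int := Fps (fun n => euler_trunc n n).

Lemma feqm_euler_trunc M N : (M <= N)%N -> feqm M.+1 (euler_trunc M) (euler_trunc N).
Proof.
elim: N => [|N IH]; first by rewrite leqn0 => /eqP ->.
rewrite leq_eqVlt => /orP [/eqP -> //|]; rewrite ltnS => hM.
apply: feqm_trans (IH hM) _; rewrite {2}/euler_trunc big_nat_recr //= -/(euler_trunc N).
rewrite -{1}[euler_trunc N]mulr1; apply: feqmM => //; rewrite -{1}[1 : fps int]subr0.
apply: feqmD => //; apply: feqmN => n hn; rewrite fcoefXn fcoef0.
by case: eqP => // h; lia.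
Qed.

Lemma feqm_euler_prod N : feqm N.+1 euler_prod (euler_trunc N).
Proof. by by move=> n; rewrite ltnS => hn; apply: (feqm_euler_trunc hn). Qed.

Lemma euler_prod_0 : euler_prod 0%N = 1.
Proof. by rewrite /= /euler_trunc big_geq. Qed.

Lemma fC_signz (a : int) : fC (signz a) = (-1) ^+ `|a|%N :> fps int.
Proof.
rewrite -signr_odd /signz (_ : evenz a = ~~ odd `|a|%N); last by rewrite /evenz; lia.
case: odd => /=; apply: fpsP => -[|n]; rewrite ?expr1 ?expr0 ?fcoefN ?fcoef1 //=.
Qed.

Section GaussFinite.

Let v s : fps int := (1 + fX ^+ s)^-1.
Let vK s : (0 < s)%N -> (1 + fX ^+ s) * v s = 1.
Proof.
move=> hs; rewrite /v divrr // funit1 // fcoefD fcoef1 fcoefXn.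
by case: s hs.
Qed.
Let K s n : fps int := \prod_(s.+1 <= k < n.+1) ((1 - fX ^+ k) * v k).
Let T n : fps int :=
  \sum_(1 <= s < n.+1) (-1) ^+ s * (K s n * fX ^+ (s * n.+1) * v s).
Let S n : fps int :=
  1 + 2 * \sum_(1 <= s < n.+1) (-1) ^+ s * fX ^+ (s ^ 2).

(* Shanks' finite form of Gauss' identity for phi_m. *)
Lemma gauss_shanks n : S n = K 0 n + 2 * T n.
Proof.
elim: n => [|n IH].
  by rewrite /S /T /K !big_geq.
rewrite /S big_nat_recr //= mulrDr addrA -/(S n) IH.
have vv := vK (ltn0Sn n); set v' := v n.+1 in vv; set a := fX ^+ n.+1 in vv.
(* For s <= n, the s-th summand of T n minus that of T (n + 1) is the increment of (-1)^s H s, so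
   the difference telescopes. *)
pose H s := K s n * (fX ^+ (s * n.+1) * a) * v'.
have KS s : (s <= n)%N -> K s n.+1 = K s n * ((1 - a) * v').
  by move=> hs; rewrite /K big_nat_recr.
have -> : T n.+1 = T n - ((-1) ^+ n * H n - H 0%N) +
    (-1) ^+ n.+1 * (fX ^+ (n.+1 ^ 2) * a * v').
  rewrite /T big_nat_recr //=; congr (_ + _); last first.
    rewrite /K big_geq // mul1r; congr (_ * (_ * _)).
    by rewrite /a -exprD -mulnn; congr (_ ^+ _); lia.
  have -> : (-1) ^+ n * H n - H 0%N =
      \sum_(1 <= s < n.+1) ((-1) ^+ s * H s - (-1) ^+ s.-1 * H s.-1).
    elim: (n) => [|m IHm]; first by rewrite big_geq // mul1r subrr.
    by rewrite big_nat_recr //= -IHm; ring.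
  rewrite -sumrB; apply: eq_big_nat => s /andP [s1 sn].
  case: s s1 sn => // s _ sn; rewrite KS // /H /=.
  have -> : K s n = ((1 - fX ^+ s.+1) * v s.+1) * K s.+1 n.
    by rewrite /K big_ltn.
  have -> : fX ^+ (s.+1 * n.+2) = fX ^+ (s.+1 * n.+1) * fX ^+ s.+1 :> fps int.
    by rewrite -exprD; congr (_ ^+ _); lia.
  have -> : fX ^+ (s.+1 * n.+1) = fX ^+ (s * n.+1) * a :> fps int.
    by rewrite -exprD; congr (_ ^+ _); lia.
  have vs := vK (ltn0Sn s).
  set b := fX ^+ s.+1 in vs *; set w := v s.+1 in vs *; set c := fX ^+ (s * _).
  set k := K _ _; set e := (-1) ^+ s.
  rewrite exprS -/e.
  apply/eqP; rewrite -subr_eq0; apply/eqP.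
  transitivity (e * k * (c * a) * (w * (1 - (1 + a) * v') - a * v' * (1 - (1 + b) * w))).
    by ring.
  by rewrite vv vs; ring.
have Knn : K n n = 1 by rewrite /K big_geq.
rewrite KS // /H Knn mul0n expr0 !mul1r.
have -> : fX ^+ (n * n.+1) * a = fX ^+ (n.+1 ^ 2) :> fps int.
  by rewrite -exprD -mulnn; congr (_ ^+ _); lia.
set x := fX ^+ _; set k := K _ _; set e := (-1) ^+ n; rewrite exprS -/e.
apply/eqP; rewrite -subr_eq0; apply/eqP.
transitivity ((k - 2 * (e * x)) * (1 - (1 + a) * v')); first by ring.
by rewrite vv; ring.
Qed.

Lemma phi_m_trunc n : feqm n.+1 phi_m (S n).
Proof.
pose F (a : int) : fps int := fC (signz a) * fX ^+ (`|a| ^ 2)%N.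
have perm m : perm_eq (zbox m.+1) [:: m.+1%:Z, - m.+1%:Z & zbox m].
  apply: uniq_perm; rewrite ?uniq_zbox //.
    by rewrite cons_uniq cons_uniq uniq_zbox in_cons !mem_zbox; lia.
  by move=> x; rewrite mem_zbox [RHS]in_cons [X in _ || X]in_cons mem_zbox; lia.
have sumE m : \sum_(a <- zbox m) F a = S m.
  elim: m => [|m IH].
    rewrite (_ : zbox 0 = [:: 0]) // big_seq1 /F fC_signz absz0 exp0n // !expr0.
    by rewrite /S big_geq // mulr0 addr0 mulr1.
  rewrite (perm_big _ (perm m)) big_cons big_cons IH /S [in RHS]big_nat_recr //= /F.
  by rewrite !fC_signz abszN absz_nat; ring.
rewrite -sumE => k hk; rewrite fcoef_sum /phi_m (@theta1_box _ _ n) //.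
apply: eq_bigr => a _; rewrite /F fcoefCM fcoefXn.
have -> : (a * a == k%:Z) = (k == `|a| ^ 2)%N.
  by rewrite -mulnn; lia.
by case: eqP; rewrite ?mulr1 ?mulr0.
Qed.

(** In [gauss_shanks] the sum T n vanishes up to degree n, so [phi_m] is the limit of the products
    of (1 - X^k) / (1 + X^k), while the dilated Euler product is the product of (1 - X^k) (1 +
    X^k). *)
Lemma gauss_phi : phi_m * dilate 2 euler_prod = euler_prod ^+ 2.
Proof.
apply: feqm_eq => n; apply: (@feqm_leq _ n n.+1) => //.
have hK : feqm n.+1 phi_m (K 0 n).
  apply: feqm_trans (@phi_m_trunc n) _; rewrite gauss_shanks.
  rewrite -[X in feqm _ _ X]addr0; apply: feqmD => //; apply: feqm_lowM1.
  move=> k hk; rewrite fcoef_sum big_nat big1 // => s /andP [s1 sn].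
  have -> : (-1) ^+ s * (K s n * fX ^+ (s * n.+1) * v s) =
    fX ^+ (s * n.+1) * ((-1) ^+ s * K s n * v s) by ring.
  by rewrite fcoefXnM ifF //; nia.
have hP2 : feqm n.+1 (dilate 2 euler_prod) (euler_trunc n * \prod_(1 <= k < n.+1) (1 + fX ^+ k)).
  apply: (@feqm_leq _ _ (2 * n.+1)); first by lia.
  apply: feqm_trans (feqm_dilate _ (@feqm_euler_prod n)) _ => //.
  rewrite /euler_trunc (big_morph (dilate 2) (fun a b => dilateM a b (isT : 0 < 2)%N)
    (@dilate1 _ 2 isT)).
  rewrite -big_split /= (eq_bigr (fun k => (1 - fX ^+ k) * (1 + fX ^+ k))) //.
  by move=> k _; rewrite dilateD dilateN dilate1 // dilateX // dilatefX // -exprM mulnC exprM; ring.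
apply: feqm_trans (feqmM hK hP2) _.
have -> : K 0 n * (euler_trunc n * \prod_(1 <= k < n.+1) (1 + fX ^+ k)) = euler_trunc n ^+ 2.
  rewrite mulrCA expr2; congr (_ * _).
  rewrite /K -big_split /=; apply: eq_big_nat => k /andP [k1 _].
  by rewrite -mulrA [v k * _]mulrC vK // mulr1.
by apply: feqmX; apply: feqm_sym; apply: feqm_euler_prod.
Qed.
End GaussFinite.

Local Notation P d := (dilate d euler_prod).

Lemma euler_dilate_neq0 d : P d != 0.
Proof. by apply/eqP => /(congr1 (fun f : fps int => f 0%N)); rewrite dilate0 euler_prod_0. Qed.

(** The geometric mean relation expresses [phi_p] through [phi_m] at X and X^2, whose products are
    known. *)
Lemma phi_p_prod : phi_p * euler_prod ^+ 2 * P 4 ^+ 2 = P 2 ^+ 5.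
Proof.
have := congr1 (dilate 2) gauss_phi; rewrite dilateM // dilateX // dilateA // => e.
rewrite -gauss_phi mulrA phi_mul.
by transitivity ((h1 * P 4) ^+ 2 * P 2); [ring|rewrite e; ring].
Qed.

(** Write (x^2 - y^2)^2 as (x^2 + y^2)^2 - 4 x^2 y^2 and apply the mean relations: this gives 4
    (f1^4 - h1^4), whose factor f1^2 + h1^2 is again a mean. *)
Lemma phi_gap_dilate : phi_gap ^+ 2 = 8 * dilate 2 phi_gap * dilate 4 phi_p ^+ 2.
Proof.
have e1 : 2 * f1 ^+ 2 = f0 ^+ 2 + h0 ^+ 2 by rewrite phi_sqD.
have e2 : h1 ^+ 2 = f0 * h0 by rewrite phi_mul.
have := congr1 (dilate 2) e1.
rewrite dilateM // dilate_nat // dilateD !dilateX // !dilateA // => e3.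
transitivity ((f0 ^+ 2 + h0 ^+ 2) ^+ 2 - 4 * (f0 * h0) ^+ 2); first by rewrite /phi_gap; ring.
rewrite -e1 -e2 /phi_gap dilateD dilateN !dilateX //.
transitivity (4 * (f1 ^+ 2 - h1 ^+ 2) * (f1 ^+ 2 + h1 ^+ 2)); first by ring.
by rewrite -e3; ring.
Qed.

(* Both sides satisfy a^2 P16^4 = 8 a(X^2) P8^8 and agree modulo X^2, which
   determines a. *)
Lemma phi_gap_prod : phi_gap * P 4 ^+ 2 = 8 * fX * P 8 ^+ 4.
Proof.
set a := LHS; set b := RHS.
have e4 := congr1 (dilate 4) phi_p_prod.
rewrite !(dilateM, dilateX, dilateA) // in e4.
have ha : a ^+ 2 * P 16 ^+ 4 = 8 * dilate 2 a * P 8 ^+ 8.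
  rewrite /a dilateM // dilateX // dilateA //.
  apply: (mulfI (expf_neq0 2 (euler_dilate_neq0 8))).
  transitivity (phi_gap ^+ 2 * (P 4 ^+ 4 * P 16 ^+ 4 * P 8 ^+ 2)); first by ring.
  rewrite phi_gap_dilate.
  transitivity (8 * dilate 2 phi_gap * P 8 ^+ 2 * (dilate 4 phi_p * P 4 ^+ 2 * P 16 ^+ 2) ^+ 2).
    by ring.
  by rewrite e4; ring.
have hb : b ^+ 2 * P 16 ^+ 4 = 8 * dilate 2 b * P 8 ^+ 8.
  by rewrite /b !(dilateM, dilateX, dilateA, dilate_nat, dilatefX) //; ring.
suff : a - b = 0 by move/eqP; rewrite subr_eq0 => /eqP.
(* The difference of the two quadratic equations factors as (a - b) (a + b), and a + b has a simple
   zero. *)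
apply: (@dilate2_contract (8 * P 8 ^+ 8) ((a + b) * P 16 ^+ 4)).
- rewrite dilateD dilateN mulrBr ![8 * _ * dilate 2 _]mulrAC -ha -hb; ring.
- by rewrite fcoefM0 fcoefD /a /b !fcoefM0 phi_gap0 ?fcoefX0 ?dilate0 ?euler_prod_0.
- rewrite fcoefM1 fcoefX0 dilate0 euler_prod_0 !fcoefD /a /b !(fcoefM1, fcoefM0).
  by rewrite phi_gap0 phi_gap1 ?fcoefX0 ?dilate0 ?euler_prod_0.
- by rewrite fcoefB /a /b !fcoefM0 phi_gap0 ?fcoefX0 ?dilate0 ?euler_prod_0.
- rewrite fcoefB /a /b !(fcoefM1, fcoefM0).
  by rewrite phi_gap0 phi_gap1 ?fcoefX0 ?dilate0 ?euler_prod_0.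
Qed.

(** Jacobi's formula for eta(8z)^3. Squared, it follows from the Wronskian and the product formulas;
    the coefficient of X fixes the sign. *)
Lemma jacobi_ser_prod : jacobi_ser = fX * P 8 ^+ 3.
Proof.
have e1 : 2 * f1 ^+ 2 = f0 ^+ 2 + h0 ^+ 2 by rewrite phi_sqD.
have e2 : h1 ^+ 2 = f0 * h0 by rewrite phi_mul.
have e3 := congr1 (dilate 2) phi_p_prod.
rewrite !(dilateM, dilateX, dilateA) // in e3.
have e4 := congr1 (dilate 2) gauss_phi; rewrite !(dilateM, dilateX, dilateA) // in e4.
have key : h1 ^+ 2 * phi_gap * f1 ^+ 2 = 8 * fX * P 4 ^+ 6.
  have nz : P 4 ^+ 4 * P 2 ^+ 4 * P 8 ^+ 4 != 0.
    by apply: mulf_neq0; [apply: mulf_neq0|]; apply/expf_neq0/euler_dilate_neq0.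
  apply: (mulfI nz).
  transitivity ((h1 * P 4) ^+ 2 * (phi_gap * P 4 ^+ 2) * (f1 * P 2 ^+ 2 * P 8 ^+ 2) ^+ 2).
    by ring.
  by rewrite e4 phi_gap_prod e3; ring.
have J2 : 16 * jacobi_ser ^+ 2 = 16 * (fX * P 8 ^+ 3) ^+ 2.
  transitivity (dilate 2 (2 * (h1 ^+ 2 * phi_gap * f1 ^+ 2))).
    transitivity (4 * (4%:R * jacobi_ser ^+ 2)); first by ring.
    rewrite jacobi_ser_sqr -(dilate_nat _ 4 (isT : 0 < 2)%N) -dilateM // phi_wronskian.
    congr (dilate 2 _); transitivity (h1 ^+ 2 * phi_gap * (2 * f1 ^+ 2)); last by ring.
    by rewrite e1 e2 /phi_gap; ring.
  rewrite key !(dilateM, dilateX, dilateA, dilate_nat, dilatefX) //; ring.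
have {}J2 : jacobi_ser ^+ 2 = (fX * P 8 ^+ 3) ^+ 2.
  apply: mulfI J2; apply/eqP => /(congr1 (fun f : fps int => f 0%N)).
  by rewrite fcoef_natr.
move/eqP: J2; rewrite eqf_sqr => /orP [/eqP //|/eqP h].
have := jacobi_ser1; rewrite h fcoefN fcoefXM fcoefX0 dilate0 euler_prod_0 => h2.
by lia.
Qed.

(** * The parameter s = L(2z)^(-1/2) *)

Lemma fps_neq0 (f : fps int) : f 0%N != 0 -> f != 0.
Proof. by apply: contra => /eqP ->; rewrite fcoef0. Qed.

Lemma fps_natr_neq0 k : k.+1%:R != 0 :> fps int.
Proof. by apply: fps_neq0; rewrite fcoef_natr /= pnatr_eq0. Qed.

Lemma fX_neq0 : fX != 0 :> fps int.
Proof. by apply/eqP => /(congr1 (fun f : fps int => f 1%N)). Qed.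

(* s_ser below is eta(8z) eta(32z)^2 / eta(16z)^3 = L(2z)^(-1/2), and s4 is its
   fourth power written in the variable q^4. *)
Definition sfac : fps int := P 2 * P 8 ^+ 2 * (P 4 ^+ 3)^-1.

Lemma euler_dilate_0 d : (P d) 0%N = 1. Proof. by rewrite dilate0 euler_prod_0. Qed.

Lemma sfac_eq : sfac * P 4 ^+ 3 = P 2 * P 8 ^+ 2.
Proof. by rewrite /sfac divrK // funit1 // fcoefX0 euler_dilate_0 expr1n. Qed.

Lemma sfac_0 : sfac 0%N = 1.
Proof.
have := congr1 (fun f : fps int => f 0%N) sfac_eq.
by rewrite fcoefM0 [in RHS]fcoefM0 !fcoefX0 !euler_dilate_0 !expr1n !mulr1.
Qed.

Definition s4 : fps int := fX * sfac ^+ 4.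

Lemma phi_p2_prod : f1 * P 2 ^+ 2 * P 8 ^+ 2 = P 4 ^+ 5.
Proof.
have := congr1 (dilate 2) phi_p_prod.
by rewrite !(dilateX, dilateM, dilateA).
Qed.

Lemma phi_m2_prod : h1 * P 4 = P 2 ^+ 2.
Proof.
have := congr1 (dilate 2) gauss_phi.
by rewrite !(dilateX, dilateM, dilateA).
Qed.

Lemma s4_phi_gap : 8 * f1 ^+ 2 * s4 = phi_gap.
Proof.
have nz : P 4 ^+ 12 * P 2 ^+ 4 * P 8 ^+ 4 != 0.
  by apply: mulf_neq0; [apply: mulf_neq0|]; apply/expf_neq0/euler_dilate_neq0.
apply: (mulfI nz).
transitivity (8 * fX * (f1 * P 2 ^+ 2 * P 8 ^+ 2) ^+ 2 * (sfac * P 4 ^+ 3) ^+ 4).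
  by rewrite /s4; ring.
rewrite phi_p2_prod sfac_eq.
transitivity ((8 * fX * P 8 ^+ 4) * P 4 ^+ 10 * P 2 ^+ 4 * P 8 ^+ 4); first by ring.
by rewrite -phi_gap_prod; ring.
Qed.

Lemma phi_p2_sqr : 2 * f1 ^+ 2 = f0 ^+ 2 + h0 ^+ 2.
Proof. by rewrite phi_sqD. Qed.

(** By [s4_phi_gap], 4 s4 is (f0^2 - h0^2) / (f0^2 + h0^2), whose derivative involves f0 and h0 only
    through their Wronskian. *)
Lemma fD_s4 : fD s4 = (f0 * h0) ^+ 2 * s4.
Proof.
have e : 4 * (f0 ^+ 2 + h0 ^+ 2) * s4 = f0 ^+ 2 - h0 ^+ 2.
  by rewrite -/phi_gap -s4_phi_gap -phi_p2_sqr; ring.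
have := congr1 (@fD _) e.
have -> : fD (4 * (f0 ^+ 2 + h0 ^+ 2) * s4) =
   4 * (2 * (f0 * fD f0) + 2 * (h0 * fD h0)) * s4 + 4 * (f0 ^+ 2 + h0 ^+ 2) * fD s4.
  by rewrite !fDM fDnat fDD !fD_sqr; ring.
rewrite fDD fDN !fD_sqr => e2.
have nz : 4 * (f0 ^+ 2 + h0 ^+ 2) ^+ 2 != 0.
  apply: mulf_neq0 (fps_natr_neq0 3) (expf_neq0 2 _).
  by apply: fps_neq0; rewrite fcoefD !fcoefX0 phi_p0 phi_m0.
apply: (mulfI nz).
transitivity ((f0 ^+ 2 + h0 ^+ 2) * (2 * (f0 * fD f0) - 2 * (h0 * fD h0))
   - (4 * (f0 ^+ 2 + h0 ^+ 2) * s4) * (2 * (f0 * fD f0) + 2 * (h0 * fD h0))).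
  by rewrite -e2; ring.
rewrite e.
transitivity (f0 * h0 * (4 * (h0 * fD f0 - f0 * fD h0))); first by ring.
rewrite phi_wronskian.
transitivity ((f0 * h0) ^+ 2 * (f0 ^+ 2 + h0 ^+ 2) *
   (4 * (f0 ^+ 2 + h0 ^+ 2) * s4)); last by ring.
by rewrite e; ring.
Qed.

Lemma phi_p2_s4 : f1 ^+ 2 * (1 + 4 * s4) = f0 ^+ 2.
Proof.
apply: (mulfI (fps_natr_neq0 1)).
transitivity (2 * f1 ^+ 2 + 8 * f1 ^+ 2 * s4); first by ring.
by rewrite s4_phi_gap phi_p2_sqr /phi_gap; ring.
Qed.

(* g = q g_unit(q). *)
Definition g_unit : fps int := P 4 ^+ 2 * P 8 ^+ 2.
Definition s_unit : fps int := dilate 4 sfac.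
Definition s_ser : fps int := fX * s_unit.

Lemma s_unit_0 : s_unit 0%N = 1. Proof. by rewrite dilate0 sfac_0. Qed.
Lemma s_ser_0 : s_ser 0%N = 0. Proof. by rewrite fcoefM0 mul0r. Qed.
Lemma s_ser_neq0 : s_ser != 0.
Proof. by rewrite mulf_neq0 ?fX_neq0 // fps_neq0 // s_unit_0. Qed.

Lemma s_ser_pow4 : s_ser ^+ 4 = dilate 4 s4.
Proof. by rewrite /s_ser exprMn /s4 dilateM // dilatefX // dilateX. Qed.

Lemma fD_s_ser : fD s_ser = dilate 4 (f0 * h0) ^+ 2 * s_ser.
Proof.
have := congr1 (@fD _) s_ser_pow4; rewrite fDX fD_dilate // fD_s4 dilateM // -s_ser_pow4 => e.
apply: (mulfI (mulf_neq0 (fps_natr_neq0 3) (expf_neq0 3 s_ser_neq0))).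
by rewrite e dilateX //; ring.
Qed.

(** The square root (1 + 4 s^4)^(-1/2), available as a quotient of theta values thanks to
    [phi_p2_s4]. *)
Definition u_ser : fps int := dilate 4 f1 * (dilate 4 f0)^-1.

Lemma u_ser_eq : u_ser * dilate 4 f0 = dilate 4 f1.
Proof. by rewrite /u_ser divrK // funit1 // dilate0 phi_p0. Qed.

Lemma phi_p4_neq0 : dilate 4 f0 != 0. Proof. by rewrite fps_neq0 // dilate0 phi_p0. Qed.

Lemma u_ser_0 : u_ser 0%N = 1.
Proof.
have := congr1 (fun f : fps int => f 0%N) u_ser_eq.
by rewrite fcoefM0 !dilate0 phi_p0 mulr1.
Qed.

Lemma u_ser_sqr : u_ser ^+ 2 * (1 + 4 * s_ser ^+ 4) = 1.
Proof.
apply: (mulfI (expf_neq0 2 phi_p4_neq0)).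
have e : dilate 4 (1 + 4 * s4) = 1 + 4 * s_ser ^+ 4.
  by rewrite dilateD dilate1 // dilateM // dilate_nat // -s_ser_pow4.
have := congr1 (dilate 4) phi_p2_s4; rewrite dilateM // e !dilateX // -u_ser_eq => h.
by rewrite [RHS]mulr1; apply: etrans h; ring.
Qed.

Lemma g_unit_u_ser : fX * g_unit = fD s_ser * u_ser.
Proof.
apply: (mulIf phi_p4_neq0); rewrite -[RHS]mulrA u_ser_eq fD_s_ser /s_ser /g_unit.
(* The claim in the variable w = q^4, where both sides are eta products. *)
have e : P 1 ^+ 2 * P 2 ^+ 2 * f0 = (f0 * h0) ^+ 2 * sfac * f1.
  have nz : P 4 ^+ 7 * P 2 ^+ 2 * P 8 ^+ 2 != 0.
    by apply: mulf_neq0; [apply: mulf_neq0|]; apply/expf_neq0/euler_dilate_neq0.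
  apply: (mulfI nz); rewrite phi_mul dilate_id.
  transitivity ((phi_p * euler_prod ^+ 2 * P 4 ^+ 2) * P 4 ^+ 5 * P 2 ^+ 4 * P 8 ^+ 2).
    by ring.
  rewrite phi_p_prod.
  transitivity ((sfac * P 4 ^+ 3) * (h1 * P 4) ^+ 4 * (f1 * P 2 ^+ 2 * P 8 ^+ 2));
    last by ring.
  by rewrite sfac_eq phi_m2_prod phi_p2_prod; ring.
move: e; rewrite /s_unit; move: sfac => sg0 /(congr1 (dilate 4)).
rewrite !(dilateM, dilateX, dilateA) // => e4.
by rewrite -mulrA e4; ring.
Qed.

(* The coefficients of (1 + 4 y)^(-1/2). *)
Definition altbin (j : nat) : int := (-1) ^+ j * ('C(2 * j, j))%:Z.

Lemma altbin_rec j : j.+1%:Z * altbin j.+1 = - (2 * (2 * j%:Z + 1) * altbin j).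
Proof.
have h : (j.+1 * 'C(2 * j.+1, j.+1) = 2 * (2 * j + 1) * 'C(2 * j, j))%N.
  have -> : (2 * j.+1 = (2 * j).+2)%N by lia.
  rewrite binS -(@bin_sub (2 * j).+1 j); last by lia.
  have -> : ((2 * j).+1 - j = j.+1)%N by lia.
  have /= := mul_bin_diag (2 * j).+1 j.
  move: ('C((2 * j).+1, _)) ('C(2 * j, _)) => x y; nia.
have {}h := congr1 Posz h; rewrite !PoszM PoszD PoszM in h.
by rewrite /altbin exprS mulN1r mulNr mulrN mulrCA h; ring.
Qed.

Lemma fcoefMz (f : fps int) (c : int) n : (c%:~R * f) n = c * f n.
Proof.
rewrite mulrzl; case: c => k; rewrite ?NegzE ?mulrNz ?fcoefN -?pmulrn fcoefMn.
  by rewrite -mulr_natl natz.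
by rewrite mulNr -mulr_natl natz.
Qed.

Lemma fcoef_fD (f : fps int) n : (fD f) n = n%:Z * f n.
Proof. by rewrite -[n%:Z]natz mulr_natl. Qed.

Lemma fDMz (f : fps int) (c : int) : fD (c%:~R * f) = c%:~R * fD f.
Proof. by apply: fpsP => n; rewrite !(fcoefMz, fcoef_fD) mulrCA. Qed.

(** Both v and the partial sum b solve (1 + 4 y) D f = - 2 f D y, the latter up to an error of order
    M. Hence D(b / v) vanishes to order M, and b / v is 1 to that order because its constant term is
    1. *)
Lemma inv_sqrt_expansion (y v : fps int) M :
  y 0%N = 0 -> v 0%N = 1 -> v ^+ 2 * (1 + 4 * y) = 1 ->
  feqm M v (\sum_(j < M) (altbin j)%:~R * y ^+ j).
Proof.
move=> y0 v0 hv; case: M => [|M] //; set b := \sum_(j < _) _.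
have yD k : y * fD (y ^+ k) = k%:R * y ^+ k * fD y.
  by case: k => [|k]; rewrite ?fD1 ?mulr0 ?mul0r // fDX exprS; ring.
have ode N : let b := \sum_(j < N) (altbin j)%:~R * y ^+ j in
    (1 + 4 * y) * fD b = - (2 * b * fD y) - (altbin N)%:~R * fD (y ^+ N).
  elim: N => [|N IH] /=.
    by rewrite big_ord0 expr0 fD1 (fDnat _ 0 : fD 0 = 0); ring.
  rewrite big_ord_recr /= fDD mulrDr IH fDMz fDX.
  have -> : (altbin N.+1)%:~R * (N.+1%:R * y ^+ N * fD y) =
     - (2 * (2 * N%:R + 1) * (altbin N)%:~R) * y ^+ N * fD y.
    move: (altbin_rec N); move: (altbin N.+1) (altbin N) => b1 b0 hb.
    have h : (N.+1%:Z * b1)%:~R = (- (2 * (2 * N%:Z + 1) * b0))%:~R :> fps int.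
      by rewrite hb.
    rewrite mulrNz !intrM (intrD _ (2 * N%:Z) 1) intrM in h.
    transitivity ((N.+1%:Z%:~R * b1%:~R) * (y ^+ N * fD y)); last by rewrite h; ring.
    have -> : N.+1%:R = (N.+1%:Z)%:~R :> fps int by [].
    ring.
  transitivity (- (2 * (\sum_(i < N) (altbin i)%:~R * y ^+ i) * fD y) +
     4 * (altbin N)%:~R * (y * fD (y ^+ N))); first by ring.
  by rewrite yD; ring.
have vn0 : v != 0 by rewrite fps_neq0 // v0.
have odev : (1 + 4 * y) * fD v = - (2 * v * fD y).
  have := congr1 (@fD _) hv; rewrite fD1 fDM fD_sqr fDD fD1 fDM fDnat => h.
  apply: (mulfI (mulf_neq0 (fps_natr_neq0 1) vn0)).
  by rewrite -[RHS]addr0 -h; ring.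
have vunit : v \is a GRing.unit by rewrite funit1.
pose r := b / v; have br : b = r * v by rewrite /r divrK.
have Dr : fD r = - (altbin M.+1)%:~R * fD (y ^+ M.+1) * v.
  have := ode M.+1; rewrite /= -/b {1}br fDM => h.
  transitivity (fD r * (v ^+ 2 * (1 + 4 * y))); first by rewrite hv mulr1.
  transitivity (v * ((1 + 4 * y) * (fD r * v + r * fD v)) -
     r * v * ((1 + 4 * y) * fD v)); first by ring.
  by rewrite h odev br; ring.
have Dlow : feqm M.+1 (fD r) 0.
  rewrite Dr mulrC; apply: feqm_lowM1; apply: feqm_lowM1; apply: fD_low.
  exact: feqm_lowX.
have r1 : feqm M.+1 r 1.
  move=> [|n] hn.
    have b_0 : b 0%N = 1.
      rewrite /b fcoef_sum big_ord_recl big1 ?addr0.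
        by rewrite expr0 fcoefMz.
      by move=> i _; rewrite fcoefMz fcoefX0 y0 exprS mul0r mulr0.
    by transitivity (b 0%N); [rewrite br [RHS]fcoefM0 v0 mulr1|rewrite b_0].
  have := Dlow _ hn; rewrite fcoef_fD fcoef0 => /eqP.
  by rewrite mulf_eq0 => /orP [/eqP|/eqP ->].
rewrite br -{1}[v]mul1r; apply: feqmM => //; exact: feqm_sym.
Qed.

(* The power series q F(q). *)
Definition qF_ser : fps int := - (g_unit * s_unit^-1 ^+ 2).
(** By [dpow_coef_eq] this is n / l times the coefficient of q^n in s^l when l > 0; the differential
    form shows that it is an integer even if l does not divide n. *)
Definition dpow_coef l n : int := (s_ser ^+ l.-1 * fD s_ser) n.

Lemma dpow_coef_eq l n : (0 < l)%N -> l%:Z * dpow_coef l n = n%:Z * (s_ser ^+ l) n.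
Proof.
case: l => // l _; have : (fD (s_ser ^+ l.+1)) n = n%:Z * (s_ser ^+ l.+1) n.
  by rewrite /= -mulr_natl natz.
by rewrite fDX -mulrA mulr_natl fcoefMn -mulr_natl natz => <-.
Qed.

Lemma u_ser_expansion M : feqm M u_ser (\sum_(j < M) (altbin j)%:~R * s_ser ^+ (4 * j)).
Proof.
under eq_bigr do rewrite exprM.
by apply: inv_sqrt_expansion; rewrite ?u_ser_0 ?u_ser_sqr // fcoefX0 s_ser_0.
Qed.

Lemma coef_g n M : (n < M)%N ->
  (fX * g_unit) n = \sum_(j < M) altbin j * dpow_coef (4 * j).+1 n.
Proof.
move=> hn; rewrite g_unit_u_ser.
rewrite (feqmM (@feqm_refl _ M (fD s_ser)) (@u_ser_expansion M)) // mulr_sumr fcoef_sum.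
apply: eq_bigr => j _; rewrite /dpow_coef -fcoefMz; congr (fcoef _ n) => /=; ring.
Qed.

(** The expansion of F is the sum of - b_j s^(4 j - 2) D s with b_j = [altbin j]. The term j = 0 has
    a pole but is exact: - s^(-2) D s = D(s^(-1)) gives the first summand. *)
Lemma coef_F n M : (n.+1 < M)%N ->
  qF_ser n.+1 = n%:Z * s_unit^-1 n.+1 - \sum_(1 <= j < M) altbin j * dpow_coef (4 * j).-1 n.
Proof.
move=> hn; have Su : s_unit \is a GRing.unit by rewrite funit1 // s_unit_0.
have SV : s_unit * s_unit^-1 = 1 by rewrite divrr.
have egt : g_unit = (s_unit + fD s_unit) * u_ser.
  apply: (mulfI fX_neq0); rewrite g_unit_u_ser /s_ser fDM fDfX; ring.
have DV : fD s_unit^-1 = - (fD s_unit * s_unit^-1 ^+ 2).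
  have := congr1 (@fD _) SV; rewrite fDM fD1 => h.
  transitivity (s_unit^-1 * (s_unit * fD s_unit^-1)).
    by rewrite mulrA [s_unit^-1 * s_unit]mulrC SV mul1r.
  have -> : s_unit * fD s_unit^-1 = - (fD s_unit * s_unit^-1).
    by apply/eqP; rewrite -addr_eq0 addrC h.
  ring.
have eF : qF_ser = - ((s_unit + fD s_unit) * s_unit^-1 ^+ 2) * u_ser by rewrite /qF_ser egt; ring.
rewrite eF (feqmM (@feqm_refl _ M _) (@u_ser_expansion M)) //.
case: M hn => // M hn; rewrite big_ord_recl mulrDr fcoefD; congr (_ + _).
  (* With V the inverse of [s_unit], this is q D(q^(-1) V) = - V + D V. *)
  have -> : - ((s_unit + fD s_unit) * s_unit^-1 ^+ 2) * ((altbin 0)%:~R * s_ser ^+ (4 * 0)) =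
      - s_unit^-1 + fD s_unit^-1.
    rewrite /altbin muln0 !expr0 bin0 mulr1 DV.
    transitivity (- (s_unit * s_unit^-1 * s_unit^-1) - fD s_unit * s_unit^-1 ^+ 2); first by ring.
    by rewrite SV; ring.
  by rewrite fcoefD fcoefN fcoef_fD -addn1 PoszD; ring.
rewrite mulr_sumr fcoef_sum big_add1 succnK big_mkord -sumrN; apply: eq_bigr => j _.
rewrite lift0 -[RHS]mulrN /dpow_coef -[in RHS]fcoefN -[RHS]fcoefMz.
transitivity ((fX * ((altbin j.+1)%:~R * - (s_ser ^+ (4 * j.+1).-1.-1 * fD s_ser))) n.+1);
  last by rewrite fcoefXM.
congr (fcoef _ _).
have -> : s_ser ^+ (4 * j.+1) = s_ser ^+ (4 * j.+1).-1.-1 * (fX * s_unit) ^+ 2.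
  by rewrite -/s_ser -exprD; congr (_ ^+ _); lia.
rewrite {3}/s_ser fDM fDfX; set x := s_ser ^+ _.
transitivity (- (x * fX ^+ 2 * (s_unit + fD s_unit) * (s_unit * s_unit^-1) ^+ 2 *
                 (altbin j.+1)%:~R)).
  by ring.
by rewrite SV; ring.
Qed.

(** * Complex multiplication *)

Lemma mem_sqrt_ints N (a : int) : (a \in sqrt_ints N) = (a * a == N%:Z).
Proof.
by rewrite mem_filter; apply: andb_idr => /eqP h; apply: (@sqr_boxed _ N N); rewrite ?h.
Qed.

Lemma uniq_sqrt_ints N : uniq (sqrt_ints N).
Proof. by rewrite filter_uniq ?uniq_zbox. Qed.

Lemma dilate4_theta1 w :
  dilate 4 (theta1 w) = theta1 (fun b => if evenz b then w (b %/ 2)%Z else 0).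
Proof.
apply: fpsP => N; rewrite fcoef_dilate; case: ifP => [/dvdnP [M ->]|hN]; last first.
  rewrite /theta1 /= big_seq big1 // => b; rewrite mem_sqrt_ints => /eqP h.
  rewrite /evenz ifF //; apply: contraFF hN => /dvdzP [c hc].
  by apply/dvdnP; exists (absz (c * c)); rewrite hc in h; nia.
rewrite mulnK // /theta1 /=.
transitivity (\sum_(b <- map (fun c => c * 2) (sqrt_ints M))
   (if evenz b then w (b %/ 2)%Z else 0)).
  by rewrite big_map; apply: eq_bigr => c _; rewrite /evenz dvdz_mull // mulzK.
apply: perm_big; apply: uniq_perm; rewrite ?uniq_sqrt_ints //.
  by rewrite map_inj_uniq ?uniq_sqrt_ints // => x y /mulIf ->.
move=> b; rewrite mem_sqrt_ints; apply/mapP/eqP => [[c]|h].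
  by rewrite mem_sqrt_ints => /eqP h ->; nia.
have : (2 %| b * b)%Z by apply/dvdzP; exists (M%:Z * 2); rewrite h PoszM; ring.
rewrite !dvdzE abszM Euclid_dvdM // orbb -dvdzE => /dvdzP [c hc].
by exists c => //; rewrite mem_sqrt_ints; rewrite hc in h; apply/eqP; nia.
Qed.

(** For a = 1 modulo 4 and b even, (-1)^(b/2) (a + b i) is the associate of a + b i congruent to 1
    modulo 2 + 2 i, the value of a Hecke character of Q(i). The weight is its real part. *)
Definition cm_weight (a b : int) : int :=
  (if (a %% 4)%Z == 1 then a else 0) * (if evenz b then signz (b %/ 2)%Z else 0).

Lemma g_theta2 : fX * g_unit = theta2 cm_weight.
Proof.
rewrite -(theta1_mul (fun a : int => if (a %% 4)%Z == 1 then a else 0)).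
rewrite -/jacobi_ser -dilate4_theta1 -/phi_m jacobi_ser_prod.
have := congr1 (dilate 4) gauss_phi; rewrite !(dilateX, dilateM, dilateA) // => e.
transitivity (fX * P 8 ^+ 2 * (dilate 4 phi_m * dilate 8 euler_prod)); last by ring.
by rewrite e /g_unit; ring.
Qed.

(** Otherwise t = a / b satisfies t^2 = -1 modulo p, and t^p = t^3 = - t contradicts Fermat's t^p =
    t. *)
Lemma dvd_sum_squares (p : nat) (a b : int) : prime p -> (p %% 4 = 3)%N ->
  (p%:Z %| a * a + b * b)%Z -> (p%:Z %| b)%Z.
Proof.
move=> pp p4 hd.
move: hd; rewrite !(dvdz_pcharf (pchar_Fp pp)) rmorphD !rmorphM /=.
move: (a%:~R) (b%:~R) => {}a {}b /eqP h; apply: contrapT => /negP b0.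
have t2 : (a / b) * (a / b) = -1.
  have -> : (a / b) * (a / b) = (a * a) / (b * b) by rewrite invfM mulrACA.
  have -> : a * a = - (b * b) by apply/eqP; rewrite -addr_eq0 h.
  by rewrite mulNr divff // mulf_neq0.
move: (a / b) t2 => t t2.
have tp : t ^+ p = t.
  by have := expf_card t; rewrite card_Fp.
have tp2 : t ^+ p = - t.
  have hp : p = ((p %/ 4) * 4 + 3)%N by rewrite {1}(divn_eq p 4) p4.
  transitivity (t ^+ ((p %/ 4) * 4 + 3)%N); first by congr (t ^+ _).
  rewrite exprD mulnC exprM.
  have -> : t ^+ 4 = 1 by rewrite -[4%N]/(2 * 2)%N exprM !expr2 t2 mulrNN mulr1.
  by rewrite expr1n mul1r exprS expr2 t2 mulrN1.
have : t * 2%:R == 0 by rewrite mulr_natr mulr2n -{1}tp tp2 addNr.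
rewrite mulf_eq0 => /orP [/eqP t0|].
  by move: t2; rewrite t0 mul0r => /eqP; rewrite eq_sym oppr_eq0 oner_eq0.
rewrite -(dvdn_pcharf (pchar_Fp pp)) => h2.
by have := dvdn_leq (isT : 0 < 2)%N h2; have := prime_gt1 pp; lia.
Qed.

(* Since p = 3 mod 4, the pairs with a^2 + b^2 = p^2 n are the (- p a, p b) with
   a^2 + b^2 = n, and - p = 1 mod 4. *)
Lemma hecke_g (p n : nat) : prime p -> (p %% 4 = 3)%N ->
  (fX * g_unit) (p ^ 2 * n)%N = - p%:Z * (fX * g_unit) n.
Proof.
move=> pp p4; rewrite g_theta2 [LHS]/= [X in _ = _ * X]/=.
have p0 : p%:Z != 0 by have := prime_gt0 pp; lia.
pose phi (x : int * int) := (- p%:Z * x.1, p%:Z * x.2).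
transitivity (\sum_(x <- map phi (two_squares n)) cm_weight x.1 x.2); last first.
  rewrite big_map mulr_sumr; apply: eq_bigr => -[a b] _.
  rewrite /cm_weight /phi [LHS]/= [RHS]/=.
  have -> : ((- p%:Z * a) %% 4)%Z = (a %% 4)%Z.
    have -> : - p%:Z * a = - (p %/ 4).+1%:Z * a * 4 + a.
      rewrite {1}(divn_eq p 4) p4; lia.
    by rewrite modzMDl.
  have -> : evenz (p%:Z * b) = evenz b.
    rewrite /evenz !dvdzE abszM absz_nat Euclid_dvdM //.
    by have -> : (2 %| p)%N = false by rewrite dvdn2; lia.
  case: ifP => _; last by rewrite !mul0r mulr0.
  case: ifP => [/dvdzP [c ->]|_]; last by rewrite !mulr0.
  rewrite mulrA !mulzK // mulrA; congr (_ * _).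
  rewrite /signz /evenz !dvdzE abszM absz_nat Euclid_dvdM //.
  by have -> : (2 %| p)%N = false by rewrite dvdn2; lia.
apply: perm_big; apply: uniq_perm; rewrite ?uniq_two_squares //.
  rewrite map_inj_uniq ?uniq_two_squares // => -[a b] [c d] [h1 h2].
  congr pair; apply: (mulfI p0) => //.
  by apply: oppr_inj; rewrite -!mulNr.
move=> [a b]; rewrite mem_two_squares [LHS]/=; apply/eqP/mapP => [h|[[c d]]].
  have hd : (p%:Z %| a * a + b * b)%Z.
    by rewrite h; apply/dvdzP; exists (p%:Z * n%:Z); rewrite PoszM -mulnn PoszM; ring.
  have /dvdzP [d hb] := dvd_sum_squares pp p4 hd.
  rewrite addrC in hd; have /dvdzP [c ha] := dvd_sum_squares pp p4 hd.
  exists (- c, d); last by rewrite /phi /= ha hb; congr pair; ring.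
  rewrite mem_two_squares /=; apply/eqP; apply: (mulfI (mulf_neq0 p0 p0)).
  move: h; rewrite ha hb PoszM -mulnn PoszM => h; rewrite -h; ring.
rewrite mem_two_squares /= => /eqP h [-> ->]; rewrite PoszM -mulnn PoszM -h; ring.
Qed.

Lemma hecke_g_iter (p n k : nat) : prime p -> (p %% 4 = 3)%N ->
  (fX * g_unit) (p ^ (2 * k) * n)%N = (- p%:Z) ^+ k * (fX * g_unit) n.
Proof.
move=> pp p4; elim: k => [|k IH]; first by rewrite muln0 mul1n mul1r.
have -> : (p ^ (2 * k.+1) * n = p ^ 2 * (p ^ (2 * k) * n))%N.
  by rewrite mulnA -expnD; congr (_ ^ _ * _)%N; lia.
by rewrite hecke_g // IH mulrA exprS.
Qed.

(** * Frobenius congruences *)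

Section FpsMap.
Variables (R T : comNzRingType) (phi : {rmorphism R -> T}).
Definition fmap (f : fps R) : fps T := Fps (fun n => phi (f n)).
Lemma fmapM f g : fmap (f * g) = fmap f * fmap g.
Proof.
apply: fpsP => n; rewrite !fcoefM /= rmorph_sum.
by apply: eq_bigr => i _; rewrite rmorphM.
Qed.
Lemma fmap1 : fmap 1 = 1.
Proof. by apply: fpsP => n /=; rewrite rmorph_nat. Qed.
Lemma fmapX f k : fmap (f ^+ k) = fmap f ^+ k.
Proof. by elim: k => [|k IH]; rewrite ?expr0 ?fmap1 // !exprS fmapM IH. Qed.
Lemma fmap_dilate d f : fmap (dilate d f) = dilate d (fmap f).
Proof. by apply: fpsP => n /=; case: ifP; rewrite ?rmorph0. Qed.
End FpsMap.

Lemma fpsC_exp (R : comNzRingType) (c : R) k : fC c ^+ k = fC (c ^+ k).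
Proof.
elim: k => [|k IH]; first by rewrite !expr0; apply: fpsP => -[|n].
by rewrite exprS IH exprS; apply: fpsP => n; rewrite fcoefCM /=; case: n => //= n; rewrite mulr0.
Qed.

Lemma dilateC (R : comNzRingType) d (c : R) : (0 < d)%N -> dilate d (fC c) = fC c.
Proof.
move=> d0; apply: fpsP => n; rewrite fcoef_dilate /=.
case: ifP => [/dvdnP [k ->]|hn]; first by rewrite mulnK // muln_eq0 (gtn_eqF d0) orbF.
by case: eqP hn => // ->; rewrite dvdn0.
Qed.

(** Taking p-th powers is additive in characteristic p and fixes the coefficients by Fermat;
    truncation reduces the claim to finite sums of monomials. *)
Lemma fps_frobenius (p : nat) (f : fps 'F_p) : prime p -> f ^+ p = dilate p f.
Proof.
move=> pp; have p0 := prime_gt0 pp.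
have chp : p \in [pchar (fps 'F_p)].
  apply/andP; split=> //; apply/eqP; apply: fpsP => n; rewrite fcoefMn fcoef1.
  by rewrite -mulrnA mulnC mulrnA pchar_Fp_0 // mul0rn.
have trunc_eq N : feqm N f (\sum_(i < N) fC (f i) * fX ^+ i).
  move=> n hn; rewrite fcoef_sum (bigD1 (Ordinal hn)) // [X in _ = _ + X]big1.
    by rewrite addr0 fcoefCM fcoefXn eqxx mulr1.
  move=> i hi; rewrite fcoefCM fcoefXn; case: eqP => [h|]; last by rewrite mulr0.
  by case/eqP: hi; apply: val_inj.
apply: feqm_eq => N; apply: feqm_trans (feqmX p (trunc_eq N)) _.
apply: (@feqm_trans _ _ _ (dilate p (\sum_(i < N) fC (f i) * fX ^+ i))); last first.
  apply: (@feqm_leq _ N (p * N)); first by rewrite leq_pmull.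
  by apply: feqm_dilate => //; apply: feqm_sym.
rewrite -(pFrobenius_autE chp) rmorph_sum /=.
have -> : dilate p (\sum_(i < N) fC (f i) * fX ^+ i) =
          \sum_(i < N) dilate p (fC (f i) * fX ^+ i).
  by rewrite (big_morph _ (dilateD p) (dilate_0 _ p)).
rewrite (eq_bigr (fun i : 'I_N => dilate p (fC (f i) * fX ^+ i))) // => i _.
rewrite pFrobenius_autE exprMn fpsC_exp dilateM // dilateX // dilatefX // -!exprM mulnC.
congr (_ * _).
have -> : f i ^+ p = f i by have := expf_card (f i); rewrite card_Fp.
exact/esym/dilateC.
Qed.

Lemma fps_frobenius_int (p : nat) (f : fps int) : prime p ->
  exists g, f ^+ p - dilate p f = p%:R * g.
Proof.
move=> pp; exists (Fps (fun n => ((f ^+ p - dilate p f) n %/ p%:Z)%Z)).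
apply: fpsP => n; rewrite mulr_natl fcoefMn -mulr_natr natz divzK //.
rewrite (dvdz_pcharf (pchar_Fp pp)) fcoefB rmorphB /= subr_eq0; apply/eqP.
have := congr1 (fun h : fps 'F_p => h n) (fps_frobenius (fmap intr f) pp).
by rewrite -fmapX -fmap_dilate.
Qed.

(** The cofactor of x - y in x^p - y^p is congruent to p y^(p-1) modulo p, hence supplies one more
    factor p. *)
Lemma exp_congr_lift (R : comNzRingType) (p k : nat) (x y z : R) : (0 < k)%N ->
  x - y = (p ^ k)%:R * z -> exists z', x ^+ p - y ^+ p = (p ^ k.+1)%:R * z'.
Proof.
move=> k0 h.
have hx : x = y + (p ^ k)%:R * z by rewrite -h; ring.
have [w hw] : exists w, \sum_(i < p) x ^+ (p.-1 - i) * y ^+ i = p%:R * w.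
  have step i j : exists w, x ^+ i * y ^+ j = y ^+ (i + j) + p%:R * w.
    elim: i => [|i [w IH]]; first by exists 0; rewrite mul1r mulr0 addr0.
    exists (y * w + p%:R ^+ k.-1 * z * (x ^+ i * y ^+ j)).
    rewrite exprS -mulrA {1}hx mulrDl {1}IH addSn exprS.
    by rewrite natrX -{1}(prednK k0) exprS; ring.
  have sums m : (m <= p)%N -> exists w,
      \sum_(i < m) x ^+ (p.-1 - i) * y ^+ i = m%:R * y ^+ p.-1 + p%:R * w.
    elim: m => [|m IH] hm; first by exists 0; rewrite big_ord0 mul0r mulr0 addr0.
    have [w hw] := IH (ltnW hm); have [w' hw'] := step (p.-1 - m)%N m.
    exists (w + w'); rewrite big_ord_recr /= hw hw' subnK; last by lia.
    by rewrite -[in RHS]addn1 natrD; ring.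
  by have [w ->] := sums p (leqnn p); exists (y ^+ p.-1 + w); ring.
exists (z * w); rewrite subrXX h hw expnS natrM; ring.
Qed.

(** Lifting f^p = f(X^p) modulo p repeatedly gives f^(p^(v+1)) = f(X^p)^(p^v) modulo p^(v+1); it
    remains to raise to the power l / p^v. *)
Lemma fps_dwork (p v l n : nat) (f : fps int) : prime p -> (p ^ v %| l)%N ->
  ((p ^ v.+1)%N%:Z %| (f ^+ (p * l)) (p * n)%N - (f ^+ l) n)%Z.
Proof.
move=> pp /dvdnP [l' ->]; have p0 := prime_gt0 pp.
have [z hz] : exists z, (f ^+ p) ^+ (p ^ v) - (dilate p f) ^+ (p ^ v) = (p ^ v.+1)%:R * z.
  elim: v => [|v [z IH]].
    by have [g hg] := fps_frobenius_int f pp; exists g; rewrite !expr1 hg.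
  have [z' hz'] := exp_congr_lift (ltn0Sn v) IH.
  by exists z'; rewrite expnSr !exprM hz'.
set x := _ ^+ _ in hz; set y := _ ^+ (p ^ v) in hz.
have -> : f ^+ (p * (l' * p ^ v)) = x ^+ l'.
  by rewrite /x -!exprM; congr (_ ^+ _); lia.
have -> : (f ^+ (l' * p ^ v)) n = (y ^+ l') (p * n)%N.
  by rewrite /y -exprM -dilateX // dilate_mulr // mulnC.
rewrite -fcoefB subrXX hz -mulrA mulr_natl fcoefMn -mulr_natr natz.
exact: dvdz_mull.
Qed.

(** * Central binomial coefficients *)

Section PrimeToPFactorial.
Variable p : nat.
Hypothesis pp : prime p.

(** Up to sign, Morita's p-adic gamma function at n + 1. *)
Definition pfree_fact n := (\prod_(1 <= t < n.+1 | ~~ (p %| t)) t)%N.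

Lemma pfree_factS n : pfree_fact n.+1 = (pfree_fact n * (if (p %| n.+1)%N then 1 else n.+1))%N.
Proof.
rewrite /pfree_fact [LHS]big_mkcond [X in (X * _)%N]big_mkcond /= big_nat_recr //=.
by case: (p %| n.+1)%N.
Qed.

Lemma pfree_fact0 : pfree_fact 0 = 1%N. Proof. by rewrite /pfree_fact big_geq. Qed.

Lemma fact_pfree_fact n : (n`! = pfree_fact n * p ^ (n %/ p) * (n %/ p)`!)%N.
Proof.
elim: n => [|n IH]; first by rewrite pfree_fact0 div0n.
rewrite factS IH pfree_factS divnS ?prime_gt0 //; case: (boolP (p %| n.+1)%N) => [h|_] /=.
  have {1}-> : n.+1 = ((n %/ p).+1 * p)%N.
    by rewrite -{1}(divnK h) divnS ?prime_gt0 // h.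
  by rewrite add1n factS expnS; lia.
by rewrite add0n; lia.
Qed.

Lemma pfree_fact_coprime n : coprime p (pfree_fact n).
Proof.
elim: n => [|n IH]; first by rewrite pfree_fact0 coprimen1.
rewrite pfree_factS coprimeMr IH; case: ifP => h; first by rewrite coprimen1.
by rewrite prime_coprime // h.
Qed.

Lemma pfree_fact_period M x : (p %| M)%N ->
  pfree_fact (x + M) = pfree_fact M * pfree_fact x %[mod M].
Proof.
move=> hM; elim: x => [|x IH]; first by rewrite pfree_fact0 muln1.
rewrite addSn !pfree_factS -addSn (dvdn_addl _ hM) mulnA -modnMml IH modnMml.
case: ifP => // _.
by rewrite -modnMmr modnDr modnMmr.
Qed.

Lemma pfree_fact_periods M c x : (p %| M)%N ->
  pfree_fact (x + c * M) = pfree_fact M ^ c * pfree_fact x %[mod M].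
Proof.
move=> hM; elim: c => [|c IH]; first by rewrite mul0n addn0 mul1n.
rewrite mulSnr addnA pfree_fact_period // -modnMmr IH modnMmr.
by rewrite mulnA expnS.
Qed.

(** Passing from j to j + c M introduces the power 2 c of [pfree_fact M] on both sides. *)
Lemma pfree_fact_ratio M c j : (p %| M)%N ->
  pfree_fact (2 * (j + c * M)) * pfree_fact j ^ 2 =
  pfree_fact (2 * j) * pfree_fact (j + c * M) ^ 2 %[mod M].
Proof.
move=> hM; have -> : (2 * (j + c * M) = 2 * j + (2 * c) * M)%N by lia.
rewrite -modnMml pfree_fact_periods // modnMml.
rewrite -[RHS]modnMmr -modnXm pfree_fact_periods // modnXm modnMmr.
by congr (_ %% M)%N; rewrite mul2n -addnn expnD; lia.
Qed.

Hypothesis p4 : (p %% 4 = 3)%N.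

(** The multiples of p in (2 j)! and j! give p^(2 i - 1) (2 i - 1)! and p^(i - 1) (i - 1)!. The
    surplus p comes from 2 i - 1 against 2 (i - 1), and (2 i - 1)! / (i - 1)!^2 is i / 2 times the
    central binomial coefficient of i. *)
Lemma central_binomial_ratio i j : (0 < i)%N -> ((4 * j).+1 = p * (4 * i).-1)%N ->
  (2 * pfree_fact j ^ 2 * 'C(2 * j, j) = p * i * 'C(2 * i, i) * pfree_fact (2 * j))%N.
Proof.
move=> i0 hij; have hp : p = ((p %/ 4) * 4 + 3)%N by rewrite {1}(divn_eq p 4) p4.
have p0 := prime_gt0 pp.
have hj : j = ((i.-1) * p + (p - (p %/ 4).+1))%N by nia.
have dj : (j %/ p = i.-1)%N by rewrite hj divnMDl // divn_small ?addn0 //; lia.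
have d2j : ((2 * j) %/ p = (2 * i).-1)%N.
  have -> : (2 * j = (2 * i).-1 * p + (p - 2 * (p %/ 4).+1))%N by nia.
  by rewrite divnMDl // divn_small ?addn0 //; lia.
have e1 := fact_pfree_fact j; rewrite dj in e1.
have e2 := fact_pfree_fact (2 * j); rewrite d2j in e2.
have e3 := bin_fact (leq_pmull j (isT : 0 < 2)%N).
rewrite (_ : (2 * j - j = j)%N) in e3; last by lia.
have e4 := bin_fact (leq_pmull i (isT : 0 < 2)%N).
rewrite (_ : (2 * i - i = i)%N) in e4; last by lia.
case: i i0 hij hj dj d2j e1 e2 e4 => // i _ hij hj dj d2j e1 e2 e4.
rewrite (_ : ((2 * i.+1).-1 = (2 * i).+1)%N) in e2; last by lia.
rewrite (_ : (2 * i.+1 = (2 * i).+2)%N) in e4; last by lia.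
rewrite /= in e1; rewrite e1 e2 in e3.
rewrite [(2 * i).+2`!]factS [i.+1`!]factS in e4.
have pk0 : (0 < p ^ (2 * i))%N by rewrite expn_gt0 p0.
have pk : (p ^ (2 * i) = p ^ i * p ^ i)%N by rewrite mul2n -addnn expnD.
have fi0 : (0 < i`!)%N by rewrite fact_gt0.
have -> : (2 * i.+1 = (2 * i).+2)%N by lia.
rewrite expnS pk in e3.
have pi0 : (0 < p ^ i)%N by rewrite expn_gt0 p0.
move: e3 e4 fi0 pi0.
move: ('C(2 * j, j)) ('C(_, i.+1)) (p ^ i)%N (i`!) ((2 * i).+1`!).
move: (pfree_fact j) (pfree_fact (2 * j)) => a b x y q f h e3 e4 f0 q0.
have {}e3 : (x * (a ^ 2 * f ^ 2) = b * p * h)%N.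
  apply/eqP; rewrite -(@eqn_pmul2l (q * q)) ?muln_gt0 ?q0 //; apply/eqP.
  by transitivity (x * (a * q * f * (a * q * f)))%N; [lia|rewrite e3; lia].
have {}e4 : (y * (i.+1 * f ^ 2) = 2 * h)%N.
  apply/eqP; rewrite -(@eqn_pmul2l i.+1) //; apply/eqP.
  by transitivity (y * (i.+1 * f * (i.+1 * f)))%N; [lia|rewrite e4; lia].
apply/eqP; rewrite -(@eqn_pmul2r (f ^ 2)) ?expn_gt0 ?f0 //; apply/eqP.
transitivity (2 * (x * (a ^ 2 * f ^ 2)))%N; first by lia.
transitivity (p * b * (y * (i.+1 * f ^ 2)))%N; last by lia.
by rewrite e3 e4; lia.
Qed.

End PrimeToPFactorial.

(** * The p-adic congruence *)

Section Congruence.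
Variables (p k j0 : nat).
Hypotheses (pp : prime p) (p4 : (p %% 4 = 3)%N).
Hypothesis j0_eq : ((4 * j0).+1 = p * p ^ k)%N.

(* beta / alpha approximates the scalar by which Frobenius sends the class of
   F dq/q to that of g dq/q; the congruences below hold for every exponent
   4 i - 1 because alpha and beta come from the exponent p^k, p-adically close to 0. *)
Let alpha : int := pfree_fact p (2 * j0).
Let beta : int := - 8 * (-1) ^+ (p %/ 4).+1 * (pfree_fact p j0)%:Z ^+ 2.

Let p_eq : p = ((p %/ 4) * 4 + 3)%N.
Proof. by rewrite {1}(divn_eq p 4) p4. Qed.

Lemma coprime_p4 : coprime p 4.
Proof. by rewrite (coprimeXr 2 (m := p) (n := 2)) // prime_coprime // dvdn_prime2 //; lia. Qed.

(** Both 4 j + 1 and 4 j0 + 1 are divisible by p^e and p is odd, so j = j0 modulo p^e. *)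
Lemma pfree_fact_cross e i j : (e <= k)%N -> (0 < i)%N ->
  ((4 * j).+1 = p * (4 * i).-1)%N -> (p ^ e %| (4 * i).-1)%N ->
  pfree_fact p (2 * j0) * pfree_fact p j ^ 2 =
  pfree_fact p (2 * j) * pfree_fact p j0 ^ 2 %[mod p ^ e].
Proof.
move=> ek i0 hij hd; case: e ek hd => [|e] ek hd; first by rewrite !modn1.
have hpM : (p %| p ^ e.+1)%N by rewrite dvdn_exp.
have hd0 : (p ^ e.+1 %| p ^ k)%N by rewrite dvdn_exp2l.
have hc : coprime (p ^ e.+1) 4 by rewrite coprimeXl // coprime_p4.
have hj : (p ^ e.+1 %| (4 * j).+1)%N by rewrite hij dvdn_mull.
have hj0 : (p ^ e.+1 %| (4 * j0).+1)%N by rewrite j0_eq dvdn_mull.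
case: (leqP j0 j) => hle.
  have /dvdnP [c hcj] : (p ^ e.+1 %| j - j0)%N.
    rewrite -(Gauss_dvdr _ hc).
    by rewrite mulnBr -subSS dvdn_sub.
  have -> : (j = j0 + c * p ^ e.+1)%N by rewrite -hcj subnKC.
  by rewrite pfree_fact_ratio.
have /dvdnP [c hcj] : (p ^ e.+1 %| j0 - j)%N.
  rewrite -(Gauss_dvdr _ hc).
  by rewrite mulnBr -subSS dvdn_sub.
have -> : (j0 = j + c * p ^ e.+1)%N by rewrite -hcj subnKC // ltnW.
by rewrite pfree_fact_ratio.
Qed.

Lemma dvdz_cancel (q : nat) (x y : int) : coprime p `|x|%N ->
  ((p ^ q)%N%:Z %| x * y)%Z -> ((p ^ q)%N%:Z %| y)%Z.
Proof.
by move=> h; rewrite !dvdzE abszM absz_nat Gauss_dvdr // coprimeXl.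
Qed.

(** By [central_binomial_ratio] the quotient of the coefficients at j and i is, up to sign, p i b /
    (2 a^2) with a, b the p-free factorials of j and 2 j. Since 4 i = 1 modulo p^e, it behaves like
    p b / (8 a^2), which explains the 8 in [beta]; the factor p raises the precision to e + 1. *)
Lemma altbin_congr e i j : (e <= k)%N -> (0 < i)%N ->
  ((4 * j).+1 = p * (4 * i).-1)%N -> (p ^ e %| (4 * i).-1)%N ->
  ((p ^ e.+1)%N%:Z %| alpha * p%:Z * altbin i + beta * altbin j)%Z.
Proof.
move=> ek i0 hij hd.
apply: (@dvdz_cancel _ ((2 * pfree_fact p j ^ 2)%N%:Z)).
  rewrite absz_nat coprimeMr coprimeXr ?pfree_fact_coprime // andbT.
  by have := coprime_p4; rewrite (coprimeMr p 2 2) => /andP [].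
have hr := congr1 Posz (central_binomial_ratio pp p4 i0 hij).
have hs : (-1) ^+ j = (-1) ^+ (p %/ 4).+1 * (-1) ^+ i :> int.
  have op : odd p by lia.
  have hji : (j + (p %/ 4).+1 = p * i)%N by nia.
  have := congr1 odd hji; rewrite oddD oddM op /= => ho.
  rewrite -exprD -[LHS]signr_odd -[RHS]signr_odd oddD /=.
  by move: ho; case: (odd i); case: (odd j); case: (odd (p %/ 4)).
have hX := pfree_fact_cross ek i0 hij hd.
set a := pfree_fact p j in hX hr *; set b := pfree_fact p (2 * j) in hX hr.
have /dvdzP [x hx] : ((p ^ e)%N%:Z %|
    (pfree_fact p (2 * j0) * a ^ 2)%N%:Z - (b * pfree_fact p j0 ^ 2)%N%:Z)%Z.
  by rewrite -eqz_mod_dvd; apply/eqP; rewrite !modz_nat hX.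
case/dvdnP: hd => y hy.
have hy' : 4 * i%:Z = y%:Z * (p ^ e)%N%:Z + 1 by rewrite -PoszM -hy; lia.
apply/dvdzP; exists (2 * altbin i * (x - (b * pfree_fact p j0 ^ 2)%N%:Z * y%:Z)).
have pe : (p ^ e.+1)%N%:Z = p%:Z * (p ^ e)%N%:Z by rewrite expnS PoszM.
rewrite pe mulrDr.
have -> : (2 * a ^ 2)%N%:Z * (beta * altbin j) =
   beta * (-1) ^+ j * (p * i * 'C(2 * i, i) * b)%N%:Z.
  by rewrite -hr /altbin !PoszM; ring.
rewrite hs /beta /alpha /altbin.
set ep := (-1) ^+ (p %/ 4).+1; have ep2 : ep * ep = 1 by rewrite -expr2 sqrr_sign.
set ei := (-1) ^+ i; set ci := 'C(2 * i, i).
transitivity (2 * p%:Z * (ei * ci%:Z) * ((pfree_fact p (2 * j0) * a ^ 2)%N%:Z - 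
   (ep * ep) * (4 * i%:Z) * (b * pfree_fact p j0 ^ 2)%N%:Z)).
  by rewrite !PoszM; ring.
rewrite ep2 hy'.
transitivity (2 * p%:Z * (ei * ci%:Z) * (((pfree_fact p (2 * j0) * a ^ 2)%N%:Z - 
   (b * pfree_fact p j0 ^ 2)%N%:Z) - y%:Z * (p ^ e)%N%:Z * (b * pfree_fact p j0 ^ 2)%N%:Z)).
  by ring.
by rewrite hx; ring.
Qed.

(** With N = p^k n, the difference is N / l times the one in [fps_dwork]: if p^v exactly divides l,
    that congruence gives v + 1 factors p and N / l gives k - v. *)
Lemma dpow_coef_frobenius l n : (0 < l)%N ->
  ((p ^ k.+1)%N%:Z %| dpow_coef (p * l) (p * (p ^ k * n))%N - dpow_coef l (p ^ k * n)%N)%Z.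
Proof.
move=> l0; have p0 := prime_gt0 pp.
have [v [l' [hl' hl]]] : exists v l', coprime p l' /\ l = (p ^ v * l')%N.
  by case: (pfactor_coprime pp l0) => l' h1 h2; exists (logn p l), l'; rewrite mulnC.
apply: (@dvdz_cancel _ l'%:Z) => //.
have pv : (p ^ v)%N%:Z != 0 by have := expn_gt0 p v; rewrite p0; lia.
have pz : p%:Z != 0 by lia.
have hd : (p ^ v %| l)%N by rewrite hl dvdn_mulr.
have /dvdzP [z hz] := @fps_dwork p v l (p ^ k * n) s_ser pp hd.
have e1 := dpow_coef_eq (p ^ k * n) l0.
have e2 : l%:Z * dpow_coef (p * l) (p * (p ^ k * n)) =
    (p ^ k * n)%N%:Z * (s_ser ^+ (p * l)) (p * (p ^ k * n))%N.
  apply: (mulfI pz); rewrite !mulrA -!PoszM; apply: dpow_coef_eq.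
  by rewrite muln_gt0 p0.
apply/dvdzP; exists (n%:Z * z); apply: (mulfI pv).
transitivity (l%:Z * dpow_coef (p * l) (p * (p ^ k * n)) - l%:Z * dpow_coef l (p ^ k * n)%N).
  by rewrite hl PoszM; ring.
rewrite e1 e2 -mulrBr hz.
by rewrite !expnS !PoszM; ring.
Qed.

(** The disjunction covers e = min(v_p(l), k); dividing p^k n by l loses at most e factors p. *)
Lemma dvd_dpow_coef l n e : (0 < l)%N -> (e <= k)%N -> ~~ (p ^ e.+1 %| l)%N || (e == k) ->
  ((p ^ (k - e))%N%:Z %| dpow_coef l (p ^ k * n)%N)%Z.
Proof.
move=> l0 ek; case/orP => [he|/eqP ->]; last by rewrite subnn dvd1z.
case: (pfactor_coprime pp l0) => l' hl' hl.
have hv : (logn p l <= e)%N by rewrite leqNgt -pfactor_dvdn.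
have p0 := prime_gt0 pp; set v := logn p l in hv hl.
have pv : (p ^ v)%N%:Z != 0 by have := expn_gt0 p v; rewrite p0; lia.
apply: (@dvdz_cancel _ l'%:Z) => //.
apply/dvdzP; exists ((p ^ (e - v) * n)%N%:Z * (s_ser ^+ l) (p ^ k * n)%N).
apply: (mulfI pv); transitivity (l%:Z * dpow_coef l (p ^ k * n)%N).
  by rewrite {2}hl PoszM; ring.
rewrite dpow_coef_eq //.
have -> : (p ^ k = p ^ v * p ^ (e - v) * p ^ (k - e))%N.
  by rewrite -!expnD; congr (_ ^ _)%N; lia.
by rewrite !PoszM; ring.
Qed.

Let J i := (p * i - (p %/ 4).+1)%N.

Let J_eq i : (0 < i)%N -> ((4 * J i).+1 = p * (4 * i).-1)%N.
Proof. by move=> i0; rewrite /J; nia. Qed.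

(** If 4 j + 1 = p c, then c = 3 modulo 4, so c = 4 i - 1 and j = [J i]. *)
Lemma J_reindex (G : nat -> int) I : (0 < I)%N ->
  \sum_(0 <= j < J I | (p %| (4 * j).+1)%N) G j = \sum_(1 <= i < I) G (J i).
Proof.
move=> I0; have p0 := prime_gt0 pp.
rewrite -(big_map J xpredT) -[LHS]big_filter; apply: perm_big; apply: uniq_perm.
- by rewrite filter_uniq ?iota_uniq.
- rewrite map_inj_in_uniq ?iota_uniq // => x y.
  by rewrite !mem_index_iota => /andP [x0 _] /andP [y0 _]; rewrite /J; nia.
move=> j; rewrite mem_filter mem_index_iota; apply/andP/mapP.
  case=> /dvdnP [c hc] /andP [_ hj].
  have c4 : (c %% 4 = 3)%N.
    have : ((c * p) %% 4 = 1)%N by rewrite -hc; lia.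
    rewrite -modnMm p4.
    have : (c %% 4 < 4)%N by rewrite ltn_mod.
    by case: (c %% 4)%N => [|[|[|[|]]]].
  have hcc := divn_eq c 4; rewrite c4 in hcc.
  exists (c %/ 4).+1; last by rewrite /J; nia.
  rewrite mem_index_iota /=; move: hj; rewrite /J; nia.
case=> i; rewrite mem_index_iota => /andP [i0 iI] ->.
by rewrite J_eq // dvdn_mulr //; split=> //; rewrite /J; nia.
Qed.

Lemma F_g_congr n : (0 < n)%N ->
  ((p ^ k.+1)%N%:Z %| alpha * p%:Z * qF_ser (p ^ k * n).+1
     - beta * (fX * g_unit) (p * (p ^ k * n))%N)%Z.
Proof.
move=> n0; have p0 := prime_gt0 pp; set N := (p ^ k * n)%N; set q := (p ^ k.+1)%N%:Z.
(* Large enough for both expansions, as J I exceeds p N; cutting the series of g at J I makes its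
   multiples of p match the range of i exactly. *)
pose I := N.+2.
rewrite (@coef_F N I) // (@coef_g _ (J I)); last by rewrite /J /I; nia.
rewrite -(big_mkord xpredT (fun j => altbin j * dpow_coef (4 * j).+1 (p * N))).
rewrite [\sum_(0 <= j < J I) _](bigID (fun j => p %| (4 * j).+1)%N).
rewrite [X in beta * (X + _)](J_reindex
  (fun j => altbin j * dpow_coef (4 * j).+1 (p * N))) //.
set X := \sum_(0 <= i < _ | _) _.
(* Exponents prime to p: multiplying by 4 j + 1 gives a multiple of the index p N. *)
have hX : (q %| X)%Z.
  rewrite /X big_seq_cond; apply: rpred_sum => j /andP [_ hj]; apply: dvdz_mull.
  apply: (@dvdz_cancel _ ((4 * j).+1%:Z)).
    by rewrite absz_nat prime_coprime.
  by rewrite dpow_coef_eq // dvdz_mulr // /N mulnA -expnS PoszM dvdz_mulr.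
have h1 : (q %| alpha * p%:Z * (N%:Z * s_unit^-1 N.+1))%Z.
  have -> : alpha * p%:Z * (N%:Z * s_unit^-1 N.+1) = q * (alpha * n%:Z * s_unit^-1 N.+1).
    by rewrite /q expnS /N !PoszM; ring.
  exact: dvdz_mulr.
have h2 : (q %| \sum_(1 <= i < I) (alpha * p%:Z * (altbin i * dpow_coef (4 * i).-1 N) +
     beta * (altbin (J i) * dpow_coef (4 * J i).+1 (p * N))))%Z.
  rewrite big_seq; apply: rpred_sum => i; rewrite mem_index_iota => /andP [i0 _].
  rewrite J_eq //; set l := (4 * i).-1; have l0 : (0 < l)%N by rewrite /l; lia.
  (* Separates the error in the binomial ratio from the error in Frobenius. *)
  have -> : alpha * p%:Z * (altbin i * dpow_coef l N) +
      beta * (altbin (J i) * dpow_coef (p * l) (p * N)) =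
    (alpha * p%:Z * altbin i + beta * altbin (J i)) * dpow_coef l N +
    beta * altbin (J i) * (dpow_coef (p * l) (p * N) - dpow_coef l N) by ring.
  apply: rpredD; last by apply: dvdz_mull; apply: dpow_coef_frobenius.
  have [e [ek hel he]] : exists e, [/\ (e <= k)%N, (p ^ e %| l)%N &
      ~~ (p ^ e.+1 %| l)%N || (e == k)].
    exists (minn (logn p l) k); split; first exact: geq_minr.
      by rewrite pfactor_dvdn // geq_minl.
    rewrite pfactor_dvdn //; lia.
  have -> : q = (p ^ e.+1)%N%:Z * (p ^ (k - e))%N%:Z.
    by rewrite /q -PoszM -expnD addSn subnKC.
  apply: dvdz_mul; first by apply: altbin_congr => //; rewrite J_eq.
  exact: dvd_dpow_coef.
have -> : alpha * p%:Z *
     (N%:Z * s_unit^-1 N.+1 - \sum_(1 <= i < I) altbin i * dpow_coef (4 * i).-1 N) -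
   beta * (\sum_(1 <= i < I) altbin (J i) * dpow_coef (4 * J i).+1 (p * N) + X) =
   alpha * p%:Z * (N%:Z * s_unit^-1 N.+1) -
   \sum_(1 <= i < I) (alpha * p%:Z * (altbin i * dpow_coef (4 * i).-1 N) +
     beta * (altbin (J i) * dpow_coef (4 * J i).+1 (p * N))) - beta * X.
  by rewrite big_split /= -!mulr_sumr; ring.
by apply: rpredB; [apply: rpredB|apply: dvdz_mull].
Qed.

End Congruence.

(** For k = 2 m + 1 the index p^(k+1) is an even power of p, so [hecke_g_iter] applies. One p of
    (-p)^(m+1) cancels against the p beside alpha, which lowers the modulus to p^k and changes the
    sign of beta. *)
Lemma F_congr (p m : nat) : prime p -> (p %% 4 = 3)%N ->
  exists alpha beta : int, [/\ coprime p `|alpha|%N, coprime p `|beta|%N &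
   forall n, (0 < n)%N ->
    ((p ^ (2 * m).+1)%N%:Z %| alpha * qF_ser (p ^ (2 * m).+1 * n).+1
       - beta * (- p%:Z) ^+ m * (fX * g_unit) n)%Z].
Proof.
move=> pp p4; have p0 := prime_gt0 pp; set k := (2 * m).+1.
have pk4 : (p ^ k %% 4 = 3)%N.
  have p2 : (p ^ 2 %% 4 = 1)%N by rewrite -modnXm p4.
  by rewrite /k expnS expnM -modnMm p4 -modnXm p2 exp1n.
have co2 : coprime p 2.
  by rewrite prime_coprime // dvdn_prime2 //; lia.
have [j0 j0_eq] : exists j0, ((4 * j0).+1 = p * p ^ k)%N.
  exists (p * p ^ k %/ 4)%N; rewrite [RHS](divn_eq _ 4) -modnMm p4 pk4.
  by rewrite addn1 mulnC.
have h := F_g_congr pp p4 j0_eq.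
exists (pfree_fact p (2 * j0))%:Z, (- (- 8 * (-1) ^+ (p %/ 4).+1 * (pfree_fact p j0)%:Z ^+ 2)).
split.
- by rewrite absz_nat pfree_fact_coprime.
- have -> : absz (- (- 8 * (-1) ^+ (p %/ 4).+1 * (pfree_fact p j0)%:Z ^+ 2)) =
      (8 * pfree_fact p j0 ^ 2)%N.
    by rewrite abszN !abszM !abszX /= exp1n muln1.
  by rewrite coprimeMr (coprimeXr 3 co2) coprimeXr // pfree_fact_coprime.
move=> n n0; have := h n n0.
have -> : (p * (p ^ k * n) = p ^ (2 * m.+1) * n)%N.
  by rewrite mulnA -expnS; congr (_ ^ _ * _)%N; rewrite /k; lia.
rewrite hecke_g_iter // [(- p%:Z) ^+ m.+1]exprS.
move=> hn; set x := (X in (_ %| X)%Z).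
have : (p%:Z * (p ^ k)%N%:Z %| p%:Z * x)%Z.
  by rewrite -PoszM -expnS; apply: etrans hn; congr (_ %| _)%Z; rewrite /x; ring.
by rewrite dvdz_mul2l //; lia.
Qed.

(** * Eta quotients *)

Local Notation toQ := (fmap (R := int) (T := rat) intr).

Lemma feqm_fmap N (f g : fps int) : feqm N f g -> feqm N (toQ f) (toQ g).
Proof. by move=> h n hn /=; rewrite h. Qed.

Lemma toQ_1Xn k : toQ (1 - fX ^+ k) = 1 - fX ^+ k.
Proof.
apply: fpsP => n; rewrite [LHS]/= !(fcoefB, fcoef1, fcoefXn) rmorphB /=.
by rewrite !rmorph_nat.
Qed.

Lemma toQ_euler_trunc d N : (0 < d)%N ->
  toQ (dilate d (euler_trunc N)) = \prod_(1 <= k < N.+1) (1 - fX ^+ (d * k)).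
Proof.
move=> d0; rewrite /euler_trunc.
rewrite (big_morph (dilate d) (fun a b => dilateM a b d0) (@dilate1 _ d d0)).
rewrite (big_morph toQ (fmapM _) (fmap1 _)); apply: eq_bigr => k _.
by rewrite -toQ_1Xn dilateD dilateN dilate1 // dilateX // dilatefX // exprM.
Qed.

Lemma feqm_toQ_euler d N : (0 < d)%N ->
  feqm N.+1 (\prod_(1 <= k < N.+1) (1 - fX ^+ (d * k))) (toQ (P d)).
Proof.
move=> d0; rewrite -toQ_euler_trunc //; apply: feqm_fmap.
apply: (@feqm_leq _ _ (d * N.+1)); first by rewrite leq_pmull.
by apply: feqm_dilate => //; apply: feqm_sym; apply: feqm_euler_prod.
Qed.

Lemma eta_factor_pos d r N : (0 < d)%N ->
  feqm N.+1 (fpoly (eta_factor d (Posz r) N)) (toQ (P d) ^+ r).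
Proof.
move=> d0; rewrite /eta_factor fpoly_prod /=.
under eq_bigr => k _ do rewrite fpolyX fpolyD fpolyN fpoly1 fpolyXn.
by rewrite prodrXl; apply: feqmX; apply: feqm_toQ_euler.
Qed.

(** A truncated geometric series times 1 - X^(d k) is 1 - X^(d k (N + 1)), which is 1 up to degree
    N. *)
Lemma eta_factor_neg d r N : (0 < d)%N ->
  feqm N.+1 (fpoly (eta_factor d (Negz r) N) * toQ (P d) ^+ r.+1) 1.
Proof.
move=> d0; rewrite /eta_factor fpoly_prod /=.
under eq_bigr => k _ do rewrite fpolyX.
rewrite prodrXl -exprMn.
suff h : feqm N.+1 (\prod_(1 <= k < N.+1) fpoly (\sum_(j < N.+1) 'X^(d * k * j)) * toQ (P d)) 1.
  by have := @feqmX _ _ _ _ r.+1 h; rewrite expr1n.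
apply: feqm_trans (feqmM (@feqm_refl _ _ _) (feqm_sym (@feqm_toQ_euler d N d0))) _.
rewrite -big_split /= big_nat_cond.
elim/big_rec: _ => // k x /andP [/andP [k0 _] _] IH.
suff h1 : feqm N.+1 ((fpoly (\sum_(j < N.+1) 'X^(d * k * j)) : fps rat) * (1 - fX ^+ (d * k))) 1.
  by have := feqmM h1 IH; rewrite mulr1.
rewrite fpoly_sum; under eq_bigr => j _ do rewrite fpolyXn exprM.
have -> : (\sum_(j < N.+1) (fX ^+ (d * k)) ^+ j) * (1 - fX ^+ (d * k)) = 
    1 - fX ^+ (d * k * N.+1) :> fps rat.
  by rewrite (exprM _ (d * k)%N N.+1) -[RHS]opprB subrX1 -mulNr opprB mulrC.
rewrite -{2}[1]subr0; apply: feqmD => //; apply: feqmN => n hn.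
by rewrite fcoefXn fcoef0; case: eqP => // h; nia.
Qed.

Lemma g_ser_eq (n : nat) : g_ser n%:Z = ((fX * g_unit) n)%:~R.
Proof.
rewrite /g_ser /etaquot.
have -> : eta_shift [:: (4%N, 2%:Z); (8%N, 2%:Z)] = 1.
  by rewrite /eta_shift !big_cons big_nil.
case: n => [|n]; first by rewrite fcoefM0 mul0r.
have -> : n.+1%:Z - 1 = n by lia.
rewrite fcoefXM !big_cons big_nil mulr1 /=.
transitivity ((fpoly (eta_factor 4 2 n * eta_factor 8 2 n)) n); first by [].
rewrite fpolyM (feqmM (@eta_factor_pos 4 2 n isT) (@eta_factor_pos 8 2 n isT)) //.
by rewrite -!fmapX -fmapM.
Qed.

Lemma g_ser_neg (n : nat) : g_ser (Negz n) = 0.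
Proof.
rewrite /g_ser /etaquot.
have -> : eta_shift [:: (4%N, 2%:Z); (8%N, 2%:Z)] = 1.
  by rewrite /eta_shift !big_cons big_nil.
by have -> : Negz n - 1 = Negz n.+1 by lia.
Qed.

Lemma F_shift : eta_shift [:: (4%N, 2%:Z); (8%N, 2%:Z); (16%N, 6%:Z);
  (8%N, (-2)%Z); (32%N, (-4)%Z)] = -1.
Proof. by rewrite /eta_shift !big_cons big_nil. Qed.

Lemma F_ser_eq (n : nat) : F_ser (n%:Z - 1) = (qF_ser n)%:~R.
Proof.
rewrite /F_ser /etaquot F_shift opprK subrK !big_cons big_nil mulr1.
rewrite /qF_ser fcoefN rmorphN /=; congr (- _).
set e1 := eta_factor 4 _ n; set e2 := eta_factor 8 _ n; set e3 := eta_factor 16 _ n.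
set e4 := eta_factor 8 _ n; set e5 := eta_factor 32 _ n.
transitivity ((fpoly (e1 * (e2 * (e3 * (e4 * e5))))) n); first by [].
(* [Negz r] is - (r + 1), so 1 and 3 encode the exponents -2 and -4. *)
have h4 : feqm n.+1 (fpoly e4 * toQ (P 8) ^+ 2) 1 := @eta_factor_neg 8 1 n isT.
have h5 : feqm n.+1 (fpoly e5 * toQ (P 32) ^+ 4) 1 := @eta_factor_neg 32 3 n isT.
have SV : s_unit * s_unit^-1 = 1 by rewrite divrr // funit1 // s_unit_0.
have SP : s_unit * P 16 ^+ 3 = P 8 * P 32 ^+ 2.
  move: sfac_eq; rewrite /s_unit; move: sfac => sg0 /(congr1 (dilate 4)).
  by rewrite !(dilateX, dilateM, dilateA).
have PU d : P d * (P d)^-1 = 1 by rewrite divrr // funit1 // dilate0 euler_prod_0.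
have toQM := fmapM (intr : {rmorphism int -> rat}).
pose w := toQ ((P 8)^-1 ^+ 2 * (P 32)^-1 ^+ 4).
have hw : toQ (P 8) ^+ 2 * toQ (P 32) ^+ 4 * w = 1.
  rewrite /w -!fmapX -!toQM -(fmap1 intr); congr (toQ _).
  transitivity ((P 8 * (P 8)^-1) ^+ 2 * (P 32 * (P 32)^-1) ^+ 4); first by ring.
  by rewrite !PU !expr1n mulr1.
suff h : feqm n.+1 (fpoly (e1 * (e2 * (e3 * (e4 * e5)))) * (toQ (P 8) ^+ 2 * toQ (P 32) ^+ 4))
    (toQ (g_unit * s_unit^-1 ^+ 2) * (toQ (P 8) ^+ 2 * toQ (P 32) ^+ 4)).
  have e x : x * (toQ (P 8) ^+ 2 * toQ (P 32) ^+ 4) * w = x by rewrite -mulrA hw mulr1.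
  by have := feqmM h (@feqm_refl _ _ w) (ltnSn n); rewrite !e.
rewrite !fpolyM.
have -> : fpoly e1 * (fpoly e2 * (fpoly e3 * (fpoly e4 * fpoly e5))) *
   (toQ (P 8) ^+ 2 * toQ (P 32) ^+ 4) =
   (fpoly e1 * fpoly e2 * fpoly e3) *
   ((fpoly e4 * toQ (P 8) ^+ 2) * (fpoly e5 * toQ (P 32) ^+ 4)) by ring.
apply: feqm_trans (feqmM (feqmM (feqmM (@eta_factor_pos 4 2 n isT)
  (@eta_factor_pos 8 2 n isT)) (@eta_factor_pos 16 6 n isT)) (feqmM h4 h5)) _.
rewrite !mulr1 -!fmapX -!toQM.
suff -> : g_unit * s_unit^-1 ^+ 2 * (P 8 ^+ 2 * P 32 ^+ 4) = P 4 ^+ 2 * P 8 ^+ 2 * P 16 ^+ 6 by [].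
transitivity (g_unit * s_unit^-1 ^+ 2 * (P 8 * P 32 ^+ 2) ^+ 2); first by ring.
rewrite -SP; transitivity (g_unit * (s_unit * s_unit^-1) ^+ 2 * P 16 ^+ 6); first by ring.
by rewrite SV expr1n mulr1 /g_unit.
Qed.

Lemma F_ser_neg (n : nat) : F_ser (Negz n.+1) = 0.
Proof.
rewrite /F_ser /etaquot F_shift.
have -> : Negz n.+1 - -1 = Negz n by lia.
by rewrite oppr0.
Qed.

(** * p-adic valuations and the conclusion *)

Lemma vp_rat_int p (x : int) : vp_rat p x%:~R = (logn p `|x|)%:Z.
Proof. by rewrite /vp_rat numq_int denq_int absz1 logn1 subr0. Qed.

Lemma vp_rat_div p (x y : int) : x != 0 -> y != 0 ->
  vp_rat p (x%:~R / y%:~R) = (logn p `|x|)%:Z - (logn p `|y|)%:Z.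
Proof.
move=> x0 y0; set q := x%:~R / y%:~R : rat.
have q0 : q != 0 by rewrite mulf_neq0 ?invr_eq0 ?intr_eq0.
have n0 : (0 < `|numq q|)%N by rewrite absz_gt0 numq_eq0.
have d0 : (0 < `|denq q|)%N by rewrite absz_gt0 denq_eq0.
have e : numq q * y = x * denq q.
  apply: (@intr_inj rat); rewrite !rmorphM /= numqE /q.
  by rewrite mulrAC divfK ?intr_eq0.
have := congr1 (fun z : int => logn p `|z|%N) e.
rewrite !abszM !lognM ?absz_gt0 // /vp_rat; lia.
Qed.

Lemma vp_ser_ge_int p (f : int -> rat) (c : int) (F : int -> int) (m k : nat) :
  c != 0 -> logn p `|c|%N = m -> prime p ->
  (forall n, f n = (F n)%:~R / c%:~R) ->
  (forall n, (p ^ (m + k))%N%:Z %| F n)%Z ->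
  vp_ser_ge p f k%:Z.
Proof.
move=> c0 hc pp hf hd n; rewrite hf => fn0.
have F0 : F n != 0 by apply: contraNneq fn0 => ->; rewrite mul0r.
rewrite vp_rat_div // hc.
have := hd n; rewrite dvdzE absz_nat pfactor_dvdn ?absz_gt0 //; lia.
Qed.

Lemma F_ser_pos (n : nat) : F_ser n%:Z = (qF_ser n.+1)%:~R.
Proof. by rewrite -F_ser_eq; congr (F_ser _); lia. Qed.

(** The series q F is a series in q^4, so C(0) = 0. This settles the index 0, which [F_congr] leaves
    out. *)
Lemma qF_ser_1 : qF_ser 1%N = 0.
Proof.
have SV : s_unit * s_unit^-1 = 1 by rewrite divrr // funit1 // s_unit_0.
have e : dilate 4 (sfac ^+ 2) * qF_ser = - dilate 4 (euler_prod ^+ 2 * dilate 2 euler_prod ^+ 2).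
  rewrite dilateX // -/s_unit !(dilateX, dilateM, dilateA) //.
  transitivity (- ((s_unit * s_unit^-1) ^+ 2 * g_unit)); first by rewrite /qF_ser; ring.
  by rewrite SV expr1n mul1r.
have := congr1 (fun f : fps int => f 1%N) e.
have s1 (f : fps int) : (dilate 4 f) 1%N = 0 by [].
by rewrite [RHS]fcoefN fcoefM1 !s1 mul0r addr0 oppr0 dilate0 fcoefX0 sfac_0 expr1n mul1r.
Qed.

(** As [vp_rat] takes the value 0 at 0, nonvanishing is asserted separately. *)
Theorem theorem1p1 (p m : nat) :
  prime p -> (p %% 4 = 3)%N ->
  C (p ^ (2 * m + 1))%N%:Z != 0 /\
  vp_rat p (C (p ^ (2 * m + 1))%N%:Z) = m%:Z /\
  vp_ser_ge p
    (fun n => Uop (p ^ (2 * m + 1)) F_ser n / C (p ^ (2 * m + 1))%N%:Z - g_ser n)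
    (m.+1)%:Z.
Proof.
move=> pp p4; have p1 := prime_gt1 pp; have p0 := prime_gt0 pp.
rewrite addn1; set k := (2 * m).+1.
have [al [be [ca cb h]]] := F_congr m pp p4.
rewrite -/k in h; set c := qF_ser (p ^ k).+1.
have hC : C (p ^ k)%N%:Z = c%:~R by rewrite /C F_ser_pos.
have g1 : (fX * g_unit) 1%N = 1.
  by rewrite fcoefXM fcoefM0 !fcoefX0 !dilate0 euler_prod_0 !expr1n.
have h1 := h 1%N isT; rewrite muln1 -/c g1 mulr1 in h1.
have c_val : (p ^ m %| `|c|)%N /\ ~~ (p ^ m.+1 %| `|c|)%N.
  (* At n = 1 the congruence is al c = be (-p)^m modulo p^(2 m + 1), with al and be prime to p, so c
     has valuation exactly m. *)
  case/dvdzP: h1 => z hz.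
  have e : al * c = (z * (p ^ m.+1)%N%:Z + be * (-1) ^+ m) * (p ^ m)%N%:Z.
    have -> : al * c = z * (p ^ k)%N%:Z + be * (- p%:Z) ^+ m by rewrite -hz; ring.
    have -> : (p ^ k = p ^ m.+1 * p ^ m)%N by rewrite -expnD; congr (_ ^ _)%N; lia.
    have -> : (- p%:Z) ^+ m = (-1) ^+ m * (p ^ m)%N%:Z.
      by rewrite [LHS]exprNn; congr (_ * _); elim: (m) => // t IH; rewrite expnS PoszM -IH exprS.
    by rewrite PoszM; ring.
  have ea : (absz al * absz c = absz (z * (p ^ m.+1)%N%:Z + be * (-1) ^+ m)%R * p ^ m)%N.
    by rewrite -abszM e abszM absz_nat.
  have co t : coprime (p ^ t) `|al|%N by rewrite coprimeXl.
  split; rewrite -(Gauss_dvdr _ (co _)) ea; first exact: dvdn_mull.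
  rewrite expnS dvdn_pmul2r ?expn_gt0 ?p0 //.
  rewrite -[~~ _]/(~~ (p%:Z %| z * (p * p ^ m)%N%:Z + be * (-1) ^+ m)%Z).
  rewrite rpredDl; last by rewrite dvdz_mull // PoszM dvdz_mulr.
  rewrite dvdzE abszM abszX /= exp1n muln1 -prime_coprime //.
have c0 : c != 0 by case: c_val => _; apply: contraNneq => ->; rewrite dvdn0.
have vc : logn p `|c|%N = m.
  case: c_val; rewrite !pfactor_dvdn ?absz_gt0 //; lia.
rewrite hC; split; [by rewrite intr_eq0|split; first by rewrite vp_rat_int vc].
(* c times the series to be bounded. At negative n it vanishes because p^k n < -1 lies below the
   pole of F. *)
pose G n : int := if n is Posz n' then
  (if n' is 0%N then qF_ser 1%N else qF_ser (p ^ k * n').+1) - c * (fX * g_unit) n' else 0.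
apply: (@vp_ser_ge_int _ _ c G m m.+1) => // n.
  rewrite /G /Uop; case: n => [[|n]|n].
  - rewrite mulr0 F_ser_pos (g_ser_eq 0) fcoefM0 mul0r mulr0 !subr0 //.
  - rewrite -PoszM F_ser_pos g_ser_eq rmorphB rmorphM /= mulrBl mulrAC.
    by rewrite divff ?intr_eq0 // mul1r.
  rewrite g_ser_neg subr0 mul0r.
  have -> : (p ^ k)%N%:Z * Negz n = Negz (p ^ k * n.+1).-1.
    by rewrite !NegzE prednK ?muln_gt0 ?expn_gt0 ?p0 // PoszM mulrN.
  have : (1 < p ^ k * n.+1)%N.
    by rewrite (@leq_trans (p ^ k)) ?leq_pmulr // -(exp1n k) ltn_exp2r.
  case: (p ^ k * n.+1)%N => [|[|t]] // _.
  by rewrite F_ser_neg mul0r.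
have -> : (m + m.+1 = k)%N by rewrite /k; lia.
case: n => [[|n]|n]; rewrite /G ?dvdz0 //.
  by rewrite fcoefM0 mul0r mulr0 subr0 qF_ser_1 dvdz0.
(* Subtracting the congruence at 1, multiplied by the coefficient of g, eliminates [be] and leaves
   al times G. *)
have hn := h n.+1 isT.
apply: (@dvdz_cancel p k al) => //.
have -> : al * (qF_ser (p ^ k * n.+1).+1 - c * (fX * g_unit) n.+1) =
  (al * qF_ser (p ^ k * n.+1).+1 - be * (- p%:Z) ^+ m * (fX * g_unit) n.+1) -
  (fX * g_unit) n.+1 * (al * c - be * (- p%:Z) ^+ m) by ring.
by apply: rpredB => //; apply: dvdz_mull.
Qed.
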